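(* Let $n_2 \neq 1$ be a positive integer with $\gcd(6,n_2)=1$, let $s \in \mathbb{Z}$ with $s \equiv -1 \pmod 3$ and $s \equiv 1 \pmod{n_2}$, and let \[ G = C_{3n_2} \rtimes_s C_2 = \langle x, y \colon x^2 = y^{3n_2} = 1_G,\ yx = xy^s \rangle, \] a group of order $6n_2$. Then: 1. $\mathsf{E}(G) = 9n_2$. 2. Let $S$ be a sequence over $G$ of length $9n_2-1$. Then $S$ has no product-one subsequence of length $6n_2$ if and only if there exist $\alpha, \tau \in G$ such that $G = \langle \alpha, \tau \colon \tau^2 = \alpha^{3n_2} = 1_G,\ \alpha\tau = \tau\alpha^s \rangle$ and \[ S = (\alpha^{t_1})^{[6n_2-1]} \cdot (\alpha^{t_2})^{[3n_2-1]} \cdot (\tau\alpha^{t_3}) \] for some $t_1,t_2,t_3 \in \mathbb{Z}$ with $\gcd(t_1-t_2, 3n_2) = 1$.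
   Context: A sequence over a finite group $G$ is a finite unordered collection of elements of $G$ with repetition allowed (an element of the free abelian monoid on $G$, written with concatenation $\cdot$); $g^{[k]}$ denotes the sequence consisting of $k$ copies of $g$, and the length $|S|$ is the number of terms counted with multiplicity. A subsequence is a subcollection (respecting multiplicities). A sequence $S = g_1 \cdot \ldots \cdot g_k$ is product-one if there is a permutation $f$ of $[1,k]$ with $g_{f(1)} g_{f(2)} \cdots g_{f(k)} = 1_G$. The Gao constant $\mathsf{E}(G)$ is the smallest positive integer $\ell$ such that every sequence over $G$ of length at least $\ell$ has a product-one subsequence of length $|G|$. *)

(* Defs.v *)
From HB Require Import structures.
From mathcomp Require Import all_boot all_order all_algebra all_fingroup.
From mathcomp Require Import finmap multiset.

Set Implicit Arguments.
Unset Strict Implicit.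
Unset Printing Implicit Defensive.

Local Open Scope nat_scope.
Local Open Scope group_scope.
Local Open Scope mset_scope.

Definition expgz (G : groupType) (g : G) (k : int) : G :=
  match k with
  | Posz n => g ^+ n
  | Negz n => g ^- n.+1
  end.

Definition semidirect_rels (m : nat) (s : int) (H : groupType) (a t : H) : Prop :=
  [/\ t ^+ 2 = 1, a ^+ m = 1 & a * t = t * expgz a s].

(* G = < a, t : t^2 = a^m = 1, a t = t a^s >, as a property of the specific
   elements a and t: they generate G, satisfy the relations, and G is universal
   for them among all groups H, not only the finite ones (this last point is
   what makes every relation of G a consequence of the given ones). *)
Definition semidirect_presentation (gT : finGroupType) (m : nat) (s : int)
    (a t : gT) : Prop :=
  [/\ <<[set a; t]>> = [set: gT],
      semidirect_rels m s a t
    & forall (H : groupType) (b u : H), semidirect_rels m s b u ->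
        exists f : {multiplicative gT -> H}, f a = b /\ f t = u].

(* Sequences over G are the elements of the free abelian monoid on G, i.e.
   multisets; size S counts terms with multiplicity. *)
Definition product_one (gT : finGroupType) (S : {mset gT}) : Prop :=
  exists2 l : seq gT, perm_eq l S & \prod_(g <- l) g = 1.

Definition has_product_one_subseq (gT : finGroupType) (S : {mset gT})
    (k : nat) : Prop :=
  exists T : {mset gT}, [/\ T `<=` S, size T = k & product_one T].

Definition gao_property (gT : finGroupType) (l : nat) : Prop :=
  forall S : {mset gT}, l <= size S -> has_product_one_subseq S #|gT|.

(* is_gao_constant gT l reads E(G) = l. *)
Definition is_gao_constant (gT : finGroupType) (l : nat) : Prop :=
  [/\ 0 < l, gao_property gT l
    & forall l' : nat, 0 < l' -> gao_property gT l' -> l <= l'].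

(* Main.v *)
Require Import Defs.
From HB Require Import structures.
From mathcomp Require Import all_boot all_order all_algebra all_fingroup.
From mathcomp Require Import finmap multiset zify ring.

(** The group is S3 x C_n with n = n2.  Write S for a sequence of length 9n-1
    and k for the number of its terms outside the rotation subgroup C_3n.

    If k = 0, the theorem of Erdos, Ginzburg and Ziv gives two disjoint
    zero-sum blocks of length 3n.  If k = 1, two such blocks fail to exist
    exactly in the extremal case, by the inverse theorem: 2m-2 elements of
    Z/m without zero-sum block of length m take two values, m-1 times each.

    If k >= 2 there is always a product-one subsequence.  For n = p n' with p
    prime, one arranges S into 9n'-1 blocks of length p with zero sum in Z/p, two
    of which have an odd number of reflections, and argues by induction.  For n
    prime, two reflections and two nontrivial rotations (or two pairs of equal
    reflections) can be ordered to give any rotation of S3, so that only the sum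
    in Z/n matters.  Pairing the other terms so that a pair never mixes
    reflections and rotations, every sum in Z/n is attained by a subset of the
    pairs, unless almost all terms have the same Z/n-component; then the
    statement is about S3 only. *)

Set Implicit Arguments.
Unset Strict Implicit.
Unset Printing Implicit Defensive.

Import GRing.Theory.
Local Open Scope nat_scope.

(* Congruences in the context would make [lia] very slow. *)
Ltac count_lia :=
  repeat match goal with
  | H : is_true ?b |- _ =>
      lazymatch b with
      | leq _ _ => fail
      | leq _ _ && leq _ _ => fail
      | negb (@eq_op _ (modn _ _) _) => clear H
      | negb (@eq_op _ (_ : nat) _) => fail
      | _ => clear H
      end
  | H : modn _ _ = modn _ _ |- _ => clear H
  | H : ~ ex _ |- _ => clear H
  | H : forall _ : _, _ |- _ => clear H
  end; lia.

(** * Sublists up to permutation *)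

Ltac perm_lia :=
  let a := fresh "a" in
  (* Lists are permutations of each other when all their counts agree, so a rearrangement becomes a
     linear identity. *)
  apply/seq.permP => a;
  repeat match goal with
    H : is_true (perm_eq _ _) |- _ => move: (seq.permP H a); clear H end;
  rewrite ?count_cat /=; rewrite ?count_cat /=; count_lia.

(** Since s is -1 modulo 3 and 1 modulo n, the subgroup C_n is central. The projections to S3 and
    Z/n come from the universal property, so they exist for every presenting pair [alpha], [tau],
    and no isomorphism has to be built. The combinatorial statements concern lists over an arbitrary
    type with labels in S3 and in the natural numbers: a whole block can then become a single term
    of a new sequence, labelled by its product in S3 and by its sum divided by p. The obstacle in
    that induction is that a block may contain an even number of reflections: after a careless
    grouping, fewer than two terms of the new sequence might be reflections, and the induction
    hypothesis would say nothing. Hence the two odd blocks are secured before the others are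
    extracted. The bounds 6p + 3 and 6p + 2 of the prime case come from S3: nine arbitrary terms, or
    eight of equal parity, contain a product-one subsequence of length six. For p = 5 the counts
    that reach these bounds leave no slack. *)

Lemma count_split (T : eqType) (a : pred T) s i : i <= count a s ->
  exists t u, [/\ perm_eq s (t ++ u), size t = i & all a t].
Proof.
move=> le_i; exists (take i (filter a s)), (drop i (filter a s) ++ filter (predC a) s).
split; first by rewrite catA cat_take_drop perm_sym perm_filterC.
  by rewrite size_take size_filter; case: ltngtP le_i.
by apply/allP => x /mem_take; rewrite mem_filter => /andP[].
Qed.

Lemma mem_perm_cons (T : eqType) (x : T) s : x \in s ->
  exists u, perm_eq s (x :: u).
Proof. by move=> xs; exists (rem x s); exact: perm_to_rem. Qed.

Lemma has_perm_cons (T : eqType) (a : pred T) s : 0 < count a s ->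
  exists x u, perm_eq s (x :: u) /\ a x.
Proof.
rewrite -has_count => /hasP[x xs ax].
by have [u su] := mem_perm_cons xs; exists x, u.
Qed.

Lemma sub_perm (T : eqType) (t s : seq T) :
  (forall x, count_mem x t <= count_mem x s) -> exists u, perm_eq s (t ++ u).
Proof.
elim: t s => [|x t IH] s le_ts; first by exists s.
have xs : x \in s by rewrite -has_pred1 has_count; move: (le_ts x) => /=; rewrite eqxx; lia.
have [s' ss'] := mem_perm_cons xs.
have [y|u s'u] := IH s'.
  by move: (le_ts y); rewrite /= (seq.permP ss') /=; lia.
by exists u; rewrite (perm_trans ss') //= perm_cons.
Qed.

Lemma perm_flatten (T : eqType) (bs bs' : seq (seq T)) :
  perm_eq bs bs' -> perm_eq (flatten bs) (flatten bs').
Proof.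
move=> /seq.permP h; apply/seq.permP => a; rewrite !count_flatten.
by apply: perm_sumn; apply: perm_map; apply/seq.permP.
Qed.

Lemma sum_nat_perm (T : eqType) (c : T -> nat) s t : perm_eq s t ->
  \sum_(i <- s) c i = \sum_(i <- t) c i.
Proof. by move=> st; exact: perm_big. Qed.

(** * Subset sums in cyclic groups of prime order *)

(** The number of summands is recorded because every block sought has a prescribed length. *)
Definition reach (R : nmodType) (T : eqType) (f : T -> R) (s : seq T) (m : nat) (z : R) :=
  exists t u, [/\ perm_eq s (t ++ u), size t = m & (\sum_(i <- t) f i)%R = z].

Lemma reach_perm (R : nmodType) (T : eqType) (f : T -> R) s s' m z :
  perm_eq s s' -> reach f s m z -> reach f s' m z.
Proof.
move=> ss' [t [u [st tm tz]]]; exists t, u; split=> //.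
by rewrite -(permPl ss').
Qed.

Lemma reach_cons (R : nmodType) (T : eqType) (f : T -> R) s x m z :
  reach f s m z -> reach f (x :: s) m.+1 (f x + z)%R.
Proof.
move=> [t [u [st tm tz]]]; exists (x :: t), u; split=> //=.
- by rewrite perm_cons.
- by rewrite tm.
- by rewrite big_cons tz.
Qed.

Lemma reach_skip (R : nmodType) (T : eqType) (f : T -> R) s w m z :
  reach f s m z -> reach f (s ++ w) m z.
Proof.
by move=> [t [u [st tm tz]]]; exists t, (u ++ w); split=> //; perm_lia.
Qed.

Lemma reach_all (R : nmodType) (T : eqType) (f : T -> R) s w m z :
  reach f s m z -> reach f (w ++ s) (size w + m) (\sum_(i <- w) f i + z)%R.
Proof.
move=> rz; elim: w => [|x w IH]; first by rewrite big_nil add0r.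
by rewrite big_cons -addrA addSn; exact: reach_cons.
Qed.

Section PrimeSums.

Variables (p : nat) (p_pr : prime p).

(** A nonzero [d] generates the group of prime order, so repeated shifts lead from one element to
    all others. *)
Lemma shift_stable_full (A : {set 'F_p}) (d : 'F_p) : d != 0%R -> A != set0 ->
  (forall z, z \in A -> (z + d)%R \in A) -> A = setT.
Proof.
move=> d0 /set0Pn[a aA] Ad; apply/setP => z; rewrite inE.
have stab k : (a + d *+ k)%R \in A.
  by elim: k => [|k IH]; rewrite ?addr0 // mulrS addrCA addrC Ad.
have := stab (val ((z - a) / d)%R).
by rewrite -mulr_natr natr_Zp mulrC divfK // addrC subrK => ->.
Qed.

(** This is Cauchy-Davenport for a set of two elements: if the second translate adds nothing to the
    first, they coincide, and [A] is stable under the shift by [y - x]. *)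
Lemma card_two_shifts (A : {set 'F_p}) (x y : 'F_p) : x != y -> A != set0 ->
  minn p #|A|.+1 <= #|[set (x + z)%R | z in A] :|: [set (y + z)%R | z in A]|.
Proof.
move=> xy A0; set X := imset _ _; set Y := imset _ _.
have cX : #|X| = #|A| by rewrite card_imset //; exact: addrI.
have cY : #|Y| = #|A| by rewrite card_imset //; exact: addrI.
case: (boolP (Y \subset X)) => [YX|nYX]; last first.
  rewrite geq_min; apply/orP; right; rewrite -cX.
  by apply: proper_card; rewrite properE subsetUl /= subUset subxx.
have XY : X = Y by apply/eqP; rewrite eq_sym eqEcard YX cX cY leqnn.
rewrite XY setUid cY geq_min; apply/orP; left.
suff -> : A = setT by rewrite cardsT card_Fp.
apply: (@shift_stable_full A (y - x)%R) => //; first by rewrite subr_eq0 eq_sym.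
move=> z zA; have : (y + z)%R \in X by rewrite XY imset_f.
move=> /imsetP[w wA] e; suff e' : (z + (y - x) = w)%R by rewrite e'.
by rewrite addrCA addrA [(y + z)%R]e addrAC subrr add0r.
Qed.

Variables (T : eqType) (f : T -> 'F_p).

(** One term is chosen from each pair; as its two labels differ, each pair adds at least one
    attainable sum until all are attained. *)
Lemma reach_pairs (L : seq (T * T)) s m (A : {set 'F_p}) :
  all (fun u => f u.1 != f u.2) L -> A != set0 ->
  (forall z, z \in A -> reach f s m z) ->
  exists B : {set 'F_p}, [/\ minn p (#|A| + size L) <= #|B|, B != set0 &
    forall z, z \in B -> reach f (flatten [seq [:: u.1; u.2] | u <- L] ++ s) (size L + m) z].
Proof.
elim: L => [|[x y] L IH] /=.
  by move=> _ A0 h; exists A; split=> //; rewrite addn0 geq_minr.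
case/andP=> xy Ld A0 h; have [B [cB B0 hB]] := IH Ld A0 h.
exists ([set (f x + z)%R | z in B] :|: [set (f y + z)%R | z in B]); split.
- apply: leq_trans (card_two_shifts xy B0); move: cB; move: #|B| #|A| => b a; lia.
- by apply/set0Pn; case/set0Pn: B0 => z zB; exists (f x + z)%R; rewrite inE imset_f.
move=> z; rewrite inE => /orP[] /imsetP[w wB ->]; rewrite addSn.
  have /= := reach_skip [:: y] (reach_cons x (hB _ wB)).
  by apply: reach_perm; perm_lia.
have /= := reach_skip [:: x] (reach_cons y (hB _ wB)).
by apply: reach_perm; perm_lia.
Qed.

Lemma reach_pairs_full (L : seq (T * T)) z :
  all (fun u => f u.1 != f u.2) L -> size L = p.-1 ->
  reach f (flatten [seq [:: u.1; u.2] | u <- L]) p.-1 z.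
Proof.
move=> dL sL; have p1 := prime_gt1 p_pr.
have [||B [cB _ hB]] := @reach_pairs L [::] 0 [set 0%R] dL.
- by apply/set0Pn; exists 0%R; rewrite inE.
- by move=> y; rewrite inE => /eqP ->; exists [::], [::]; split; rewrite ?big_nil.
have BT : B = setT.
  apply/eqP; rewrite eqEcard subsetT /= cardsT card_Fp //.
  by apply: leq_trans cB; rewrite cards1 sL; lia.
by have := hB z; rewrite BT inE cats0 addn0 sL; apply.
Qed.

(* After sorting by label, the first q terms are paired with the last q ones:
   equal labels at distance [size s - q] would make a label too frequent. *)
Lemma distinct_pairs s q : (forall v, q <= count (fun i => f i != v) s) ->
  q.*2 <= size s ->
  exists (L : seq (T * T)) w, [/\ size L = q, all (fun u => f u.1 != f u.2) L &
    perm_eq s (flatten [seq [:: u.1; u.2] | u <- L] ++ w)].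
Proof.
move=> hq hs; case: s hq hs => [|x0 s0].
  by case: q => // _ _; exists [::], [::].
set s := x0 :: s0 => hq hs.
pose le := relpre (fun i => val (f i)) leq.
pose r := sort le s.
have rs : perm_eq r s by rewrite perm_sort.
have sr : sorted le r by apply: sort_sorted => i j; rewrite /le /= leq_total.
have szr : size r = size s by rewrite (perm_size rs).
pose d := size s - q.
pose L := zip (take q r) (drop d r).
have st : size (take q r) = q by rewrite size_takel; lia.
have sd : size (drop d r) = q by rewrite size_drop; lia.
have sL : size L = q by rewrite size_zip st sd minnn.
exists L, (drop q (take d r)); split=> //.
- apply/(all_nthP (x0, x0)) => i; rewrite sL => iq.
  rewrite nth_zip ?st ?sd //= nth_take // nth_drop.
  apply/negP => /eqP e.
  have := hq (f (nth x0 r i)).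
  have := count_predC (fun j => f j == f (nth x0 r i)) s.
  rewrite [count (predC _) s](@eq_count _ _ (fun j => f j != f (nth x0 r i))) //.
  rewrite -!(seq.permP rs).
  set cc := count (fun j => f j == _) r.
  suff : d.+1 <= cc by rewrite /d; lia.
  rewrite /cc -[X in count _ X](cat_take_drop i r) count_cat.
  rewrite -[X in _ + count _ X](cat_take_drop d.+1 (drop i r)) count_cat.
  have sz : size (take d.+1 (drop i r)) = d.+1 by rewrite size_takel // size_drop; lia.
  suff /eqP -> : count (fun j => f j == f (nth x0 r i)) (take d.+1 (drop i r)) == d.+1 by lia.
  rewrite -[X in _ == X]sz -all_count; apply/(all_nthP x0) => j.
  rewrite sz => jd; rewrite nth_take // nth_drop; apply/eqP; apply/val_inj/eqP.
  have tr : transitive le by move=> ? ? ?; exact: leq_trans.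
  have rf : reflexive le by move=> ?; exact: leqnn.
  rewrite eqn_leq; apply/andP; split.
    rewrite e; apply: (sorted_leq_nth tr rf _ sr); rewrite ?inE; lia.
  apply: (sorted_leq_nth tr rf _ sr); rewrite ?inE; lia.
- have e1 : perm_eq (flatten [seq [:: u.1; u.2] | u <- L]) (take q r ++ drop d r).
    rewrite /L; elim: (take q r) (drop d r) (etrans st (esym sd)) => [|x l IH] [|y l'] //= [sz].
    by have := IH _ sz; move=> ?; perm_lia.
  have e2 : take d r = take q r ++ drop q (take d r).
    by rewrite -[LHS](cat_take_drop q) take_takel // /d; lia.
  have e3 : r = take d r ++ drop d r by rewrite cat_take_drop.
  have e4 : perm_eq r (take q r ++ drop q (take d r) ++ drop d r) by rewrite catA -e2 -e3.
  clear -rs e1 e4; perm_lia.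
Qed.

Lemma reach_subsums s m : (forall v, p.-1 <= count (fun i => f i != v) s) ->
  p.-1 <= m <= size s - p.-1 -> forall z, reach f s m z.
Proof.
move=> hs hm z; have p1 := prime_gt1 p_pr.
have [|L [w [sL dL pw]]] := distinct_pairs hs; first lia.
have szs := perm_size pw.
have sf : size (flatten [seq [:: u.1; u.2] | u <- L]) = (size L).*2.
  by elim: (L) => //= u l ->; lia.
rewrite size_cat sf in szs.
(* The terms needed beyond one from each pair are fixed in [w], and the pairs aim at the target
   minus their sum. *)
pose w1 := take (m - p.-1) w; pose w2 := drop (m - p.-1) w.
have hz := reach_pairs_full (z - \sum_(i <- w1) f i)%R dL sL.
have := reach_skip w2 (reach_all w1 hz).
rewrite [X in reach _ _ _ X]addrC subrK size_takel; last lia.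
rewrite subnK; last lia.
apply: reach_perm; move: pw; rewrite -{1}(cat_take_drop (m - p.-1) w) -/w1 -/w2 => pw.
perm_lia.
Qed.

End PrimeSums.

(** * Zero-sum blocks and the theorem of Erdos, Ginzburg and Ziv *)

Definition cong (T : Type) (c : T -> nat) (n a : nat) : pred T :=
  fun i => c i == a %[mod n].
Arguments cong T c n a i /.

Definition block (T : Type) (c : T -> nat) (n : nat) (t : seq T) : bool :=
  (size t == n) && (n %| \sum_(i <- t) c i).

Definition has_block (T : eqType) (c : T -> nat) (n : nat) (s : seq T) : Prop :=
  exists t u, perm_eq s (t ++ u) /\ block c n t.

(** For a block the quotient is exact; it labels the block when blocks are themselves treated as
    terms. *)
Definition block_val (T : Type) (c : T -> nat) (n : nat) (t : seq T) : nat :=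
  (\sum_(i <- t) c i) %/ n.

Lemma natr_Fp_eq p a b : prime p ->
  ((a%:R : 'F_p)%R == b%:R%R) = (a == b %[mod p]).
Proof. by move=> p_pr; rewrite -val_eqE /= !val_Fp_nat. Qed.

Lemma dvdn_Fp p a : prime p -> (p %| a) = ((a%:R : 'F_p)%R == 0%R).
Proof. by move=> p_pr; rewrite (dvdn_pcharf (pchar_Fp p_pr)). Qed.

Section Blocks.

Variables (T : eqType) (c : T -> nat).
Implicit Types (s t u : seq T) (bs : seq (seq T)).

Lemma block_perm n t t' : perm_eq t t' -> block c n t = block c n t'.
Proof. by move=> tt'; rewrite /block (perm_size tt') (sum_nat_perm c tt'). Qed.

Lemma sum_const_mod n a t : all (cong c n a) t ->
  \sum_(i <- t) c i = size t * a %[mod n].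
Proof.
elim: t => [|x t IH] /=; first by rewrite big_nil.
case/andP=> /eqP cx /IH e; rewrite big_cons mulSn.
by rewrite -modnDm cx e modnDm.
Qed.

Lemma const_block n a t : size t = n -> all (cong c n a) t -> block c n t.
Proof.
by move=> st at_; rewrite /block st eqxx /dvdn (sum_const_mod at_) st modnMr.
Qed.

Lemma count_has_block n a s : n <= count (cong c n a) s -> has_block c n s.
Proof.
move=> /count_split[t [u [st tn ta]]]; exists t, u; split=> //.
exact: const_block ta.
Qed.

Lemma sum_flatten_blocks n bs : 0 < n -> all (block c n) bs ->
  size (flatten bs) = n * size bs /\
  \sum_(i <- flatten bs) c i = n * \sum_(b <- bs) block_val c n b.
Proof.
move=> n0; elim: bs => [|b bs IH] /=; first by rewrite !big_nil !muln0.
case/andP=> /andP[/eqP sb db] /IH[e1 e]; rewrite size_cat sb e1 big_cat /= e big_cons.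
by rewrite mulnDr /block_val [n * (_ %/ n)]mulnC divnK // mulnS.
Qed.

Lemma flatten_block n m bs : 0 < n -> all (block c n) bs ->
  block (block_val c n) m bs -> block c (n * m) (flatten bs).
Proof.
move=> n0 /(sum_flatten_blocks n0)[s1 s2] /andP[/eqP <- d].
by rewrite /block s1 s2 eqxx /= dvdn_pmul2l.
Qed.

End Blocks.

Definition egz (n : nat) : Prop := forall (T : eqType) (c : T -> nat) (s : seq T),
  n.*2.-1 <= size s -> has_block c n s.

(** If fewer than p - 1 terms avoid some residue, at least p terms have it and form a block;
    otherwise the sums of p terms take every value. *)
Lemma egz_prime p : prime p -> egz p.
Proof.
move=> p_pr T c s hs; have p1 := prime_gt1 p_pr.
pose f i : 'F_p := (c i)%:R%R.
case: (boolP [exists v : 'F_p, count (fun i => f i != v) s < p.-1]).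
  case/existsP=> v hv; apply: (@count_has_block _ _ _ (val v)).
  have := count_predC (fun i => f i == v) s.
  rewrite (@eq_count _ (fun i => f i == v) (cong c p (val v))).
    by rewrite [X in _ + X](@eq_count _ _ (fun i => f i != v)) //; count_lia.
  by move=> i /=; rewrite -natr_Fp_eq // natr_Zp.
move/existsPn=> hv; have [||t [u [st tm tz]]] := @reach_subsums p p_pr T f s p _ _ 0%R.
- by move=> v; have := hv v; count_lia.
- count_lia.
exists t, u; split=> //; rewrite /block tm eqxx dvdn_Fp // natr_sum.
by rewrite -/(f _) [X in X == _]tz.
Qed.

(** Blocks are removed greedily; at least 2n - 1 terms are still present when the last one is
    sought. *)
Lemma egz_extract n (T : eqType) (c : T -> nat) (s : seq T) j : egz n -> 0 < n ->
  (j.+1 * n).-1 <= size s ->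
  exists bs u, [/\ perm_eq s (flatten bs ++ u), size bs = j & all (block c n) bs].
Proof.
move=> en n0; elim: j s => [|j IH] s hs; first by exists [::], s.
have [t [u [st bt]]] : has_block c n s by apply: en; nia.
have stn : size t = n by case/andP: bt => /eqP.
have [bs [w [uw sb ab]]] : exists bs w,
    [/\ perm_eq u (flatten bs ++ w), size bs = j & all (block c n) bs].
  by apply: IH; have := perm_size st; rewrite size_cat; nia.
exists (t :: bs), w; split; rewrite /= ?sb ?bt //.
by rewrite -catA; perm_lia.
Qed.

(** The property is multiplicative: 2n' - 1 disjoint blocks of length p are available, and the
    theorem for n' = n / p selects n' of them by their values. *)
Lemma egz_gt0 n : 0 < n -> egz n.
Proof.
elim/ltn_ind: n => n IH n0; case: (ltnP 1 n) => [n1|n1]; last first.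
  have -> : n = 1 by count_lia.
  move=> T c [|x s] // _; exists [:: x], s; split=> //.
  by rewrite /block /= dvd1n.
set p := pdiv n; have p_pr : prime p by apply: pdiv_prime.
have p1 := prime_gt1 p_pr.
have np : n = p * (n %/ p) by rewrite mulnC divnK // pdiv_dvd.
set n' := n %/ p in np; have n'0 : 0 < n' by nia.
have en' : egz n' by apply: IH; nia.
move=> T c s hs.
have [||bs [u [su sb ab]]] := @egz_extract p T c s n'.*2.-1 (egz_prime p_pr) _ _.
- count_lia.
- by rewrite prednK; nia.
have [|b1 [b2 [pb bb]]] := en' _ (block_val c p) bs; first by rewrite sb.
exists (flatten b1), (flatten b2 ++ u); split.
  by have := perm_flatten pb; rewrite flatten_cat => ?; perm_lia.
rewrite np; apply: flatten_block => //; first count_lia.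
by move: ab; rewrite (perm_all _ pb) all_cat => /andP[].
Qed.

(** * The inverse problem *)

Definition inverse_egz (n : nat) : Prop :=
  forall (T : eqType) (c : T -> nat) (s : seq T), size s = n.-1.*2 ->
  ~ has_block c n s ->
  exists a b, [/\ a != b %[mod n], count (cong c n a) s = n.-1
                & count (cong c n b) s = n.-1].

Section Inverse.

Variables (T : eqType) (c : T -> nat).
Implicit Types (s t u : seq T).

Lemma count_mod_add n a b s : a != b %[mod n] ->
  count (cong c n a) s + count (cong c n b) s
  = count (predU (cong c n a) (cong c n b)) s.
Proof.
move=> ab; rewrite -count_predUI addnC.
rewrite [X in X + _](@eq_count _ _ pred0) ?count_pred0 //.
move=> i /=; apply/negP => /andP[/eqP e1 /eqP e2].
by move: ab; rewrite -e1 e2 eqxx.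
Qed.

(** A value occurring n times would give a constant block, so each occurs at most n - 1 times, and
    the length 2n - 2 forces equality. *)
Lemma two_values_counts n a b s : 1 < n -> size s = n.-1.*2 -> ~ has_block c n s ->
  all (predU (cong c n a) (cong c n b)) s ->
  exists a b, [/\ a != b %[mod n], count (cong c n a) s = n.-1
                & count (cong c n b) s = n.-1].
Proof.
move=> n1 ss nb ab; exists a, b.
have le e : count (cong c n e) s <= n.-1.
  by rewrite leqNgt; apply/negP => h; apply: nb; apply: (@count_has_block _ _ _ e); count_lia.
have ne : a != b %[mod n].
  apply/negP => /eqP e; have := le a; suff -> : count (cong c n a) s = size s by count_lia.
  by apply/eqP; rewrite -all_count; apply: sub_all ab => i /=; rewrite e orbb.
have := count_mod_add s ne; have -> : count (predU (cong c n a) (cong c n b)) s = size s.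
  by apply/eqP; rewrite -all_count.
by have := le a; have := le b; rewrite ss => *; split=> //; count_lia.
Qed.

Lemma two_values_all n a b s : a != b %[mod n] ->
  size s <= count (cong c n a) s + count (cong c n b) s ->
  all (predU (cong c n a) (cong c n b)) s.
Proof.
by move=> ab; rewrite count_mod_add // => h; rewrite all_count eqn_leq count_size.
Qed.

Lemma count_mod_congr n a e s : e = a %[mod n] ->
  count (cong c n e) s = count (cong c n a) s.
Proof. by move=> ea; apply: eq_count => i /=; rewrite ea. Qed.

Lemma two_values_mem n a b e s : a != b %[mod n] ->
  size s <= count (cong c n a) s + count (cong c n b) s ->
  0 < count (cong c n e) s -> e = a %[mod n] \/ e = b %[mod n].
Proof.
move=> ab /(two_values_all ab)/allP h; rewrite -has_count => /hasP[i /h /orP h' /eqP <-].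
by case: h' => /eqP; [left | right].
Qed.

Lemma count_mod_eq n a b e s k : a != b %[mod n] ->
  count (cong c n a) s = k ->
  count (cong c n b) s = k -> size s = k.*2 ->
  0 < count (cong c n e) s -> count (cong c n e) s = k.
Proof.
move=> ab ka kb ss he; have [] := two_values_mem ab _ he; first by rewrite ka kb ss; count_lia.
  by move=> /count_mod_congr ->.
by move=> /count_mod_congr ->.
Qed.

Lemma two_const_blocks n a b s : a != b %[mod n] ->
  n <= count (cong c n a) s -> n <= count (cong c n b) s ->
  exists t1 t2 u, [/\ perm_eq s (t1 ++ t2 ++ u), block c n t1 & block c n t2].
Proof.
move=> ab /count_split[t1 [u1 [st1 t1n at1]]] hb.
have /count_split[t2 [u [st2 t2n bt2]]] : n <= count (cong c n b) u1.
  move: hb; rewrite (seq.permP st1) count_cat.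
  rewrite (eqP (_ : count (cong c n b) t1 == 0)) //.
  rewrite -leqn0 leqNgt -has_count; apply/negP => /hasP[i it].
  by have /= /eqP-> := allP at1 _ it; exact/negP.
exists t1, t2, u; split; [perm_lia | exact: const_block at1 | exact: const_block bt2].
Qed.

End Inverse.

(** Once a block [t] is removed, the inverse theorem describes the other 2n - 2 terms by two values
    a and b. The point is that [t] takes no other value; if it took both, each would occur n times
    in [s] and give a constant block, so [t] is constant. *)
Lemma no_disjoint_blocks_counts n (T : eqType) (c : T -> nat) (s : seq T) :
  1 < n -> inverse_egz n -> size s = 3 * n - 2 ->
  ~ (exists t1 t2 u, [/\ perm_eq s (t1 ++ t2 ++ u), block c n t1 & block c n t2]) ->
  exists a b, [/\ a != b %[mod n], count (cong c n a) s = n.*2.-1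
                & count (cong c n b) s = n.-1].
Proof.
move=> n1 inv ss nb.
have en : egz n by apply: egz_gt0; count_lia.
have [|t [w [st bt]]] := en T c s; first count_lia.
have stn : size t = n by case/andP: bt => /eqP.
have sw : size w = n.-1.*2 by have := perm_size st; rewrite size_cat; count_lia.
have nbw : ~ has_block c n w.
  by move=> [t2 [u [wt bt2]]]; apply: nb; exists t, t2, u; split=> //; perm_lia.
have [a [b [ab wa wb]]] := inv _ _ _ sw nbw.
have allw := two_values_all ab (_ : size w <= _ + _).
have {}allw : all (predU (cong c n a) (cong c n b)) w.
  by apply: allw; rewrite wa wb sw; count_lia.
have allt : all (predU (cong c n a) (cong c n b)) t.
  apply/allP => x xt; apply/negP => /negP; rewrite negb_or => /andP[xa xb].
  have [t' tt'] := mem_perm_cons xt.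
  (* A foreign term [x] completes [w] to 2n - 1 terms, and the block found must contain [x]. Its
     other n - 1 terms are not all congruent, since otherwise [x] would share their value. *)
  have [|B [V [pB bB]]] := en T c (x :: w); first by rewrite /= sw; count_lia.
  have sB : size B = n by case/andP: bB => /eqP.
  have : x \in B ++ V by rewrite -(perm_mem pB) inE eqxx.
  rewrite mem_cat => /orP[xB|xV]; last first.
    have [V' VV'] := mem_perm_cons xV.
    apply: nbw; exists B, V'; split=> //.
    by rewrite -(perm_cons x); perm_lia.
  have [B' BB'] := mem_perm_cons xB.
  have pw : perm_eq w (B' ++ V) by rewrite -(perm_cons x); perm_lia.
  have sB' : size B' = n.-1 by have := perm_size BB'; rewrite /= sB; count_lia.
  have allB : all (predU (cong c n a) (cong c n b)) B'.
    by move: allw; rewrite (perm_all _ pw) all_cat => /andP[].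
  have cB := count_mod_add c B' ab.
  rewrite (eqP (_ : count (predU (cong c n a) (cong c n b)) B' == size B')) in cB;
    last by rewrite -all_count.
  have nB e : c x != e %[mod n] -> count (cong c n e) B' <> n.-1.
    move=> xe h; move/negP: xe; apply.
    have /(sum_const_mod) hs : all (cong c n e) B' by rewrite all_count h sB'.
    move: bB; rewrite (block_perm _ _ BB') => /andP[_]; rewrite big_cons /dvdn.
    rewrite -modnDmr hs modnDmr sB' => h0.
    have : c x + n.-1 * e + e == 0 + e %[mod n] by rewrite eqn_modDr mod0n.
    by rewrite -addnA -mulSnr prednK ?(ltnW n1) // [n * e]mulnC [c x + _]addnC modnMDl add0n.
  have nBa := nB _ xa; have nBb := nB _ xb.
  (* Outside [B] there are again 2n - 2 terms without a block. Both a and b are present there, as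
     [B'] exhausts neither, so each occurs n - 1 times. *)
  have [a' [b' [ab' ca cb]]] : exists a' b', [/\ a' != b' %[mod n],
      count (cong c n a') (t' ++ V) = n.-1 &
      count (cong c n b') (t' ++ V) = n.-1].
    apply: inv; first by rewrite size_cat; have := perm_size pw; have := perm_size tt';
      rewrite size_cat /=; count_lia.
    by move=> [t2 [u [wt bt2]]]; apply: nb; exists B, t2, u; split=> //; clear -st tt' pB BB' pw wt; perm_lia.
  have sTV : size (t' ++ V) = n.-1.*2.
    by rewrite size_cat; have := perm_size pw; have := perm_size tt'; rewrite size_cat /=; count_lia.
  have wab e := seq.permP pw (cong c n e).
  have := wab a; have := wab b; rewrite wa wb !count_cat => wb' wa'.
  have ha := @count_mod_eq _ _ _ _ _ a _ _ ab' ca cb sTV.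
  have hb := @count_mod_eq _ _ _ _ _ b _ _ ab' ca cb sTV.
  rewrite !count_cat in ha hb.
  have {}ha := ha (ltac:(count_lia)); have {}hb := hb (ltac:(count_lia)).
  (* Comparing with [w], the list [t'] contains a as often as [B'] does, hence at least once, and
     likewise b: each occurs n times in [s]. *)
  apply: nb; apply: (two_const_blocks ab).
    by rewrite (seq.permP st) count_cat (seq.permP tt') /= wa; count_lia.
  by rewrite (seq.permP st) count_cat (seq.permP tt') /= wb; count_lia.
have ct := count_mod_add c t ab.
rewrite (eqP (_ : count (predU (cong c n a) (cong c n b)) t == size t)) in ct;
  last by rewrite -all_count.
have sa : count (cong c n a) s = count (cong c n a) t + n.-1.
  by rewrite (seq.permP st) count_cat wa.
have sb : count (cong c n b) s = count (cong c n b) t + n.-1.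
  by rewrite (seq.permP st) count_cat wb.
have [e|ne] := eqVneq (count (cong c n a) t) n.
  by exists a, b; split=> //; count_lia.
have [e|ne'] := eqVneq (count (cong c n b) t) n.
  by exists b, a; split; [rewrite eq_sym | count_lia | count_lia].
by case: nb; apply: (two_const_blocks ab); count_lia.
Qed.

(** * The inverse theorem for an odd prime *)

Section InversePrime.

Variables (p : nat) (p_pr : prime p) (p_gt2 : 2 < p) (T : eqType) (c : T -> nat).
Let f i : 'F_p := ((c i)%:R)%R.

(** The sums of two of [x], [y], [z] already take three values, so p - 3 further pairs suffice to
    reach every residue. With the single unpaired term this makes 2 + (p - 3) + 1 = p terms. *)
Lemma triple_has_block x y z s : size s = (p - 3).*2.+1 ->
  f x != f y -> f x != f z -> f y != f z ->
  (forall v, p - 3 <= count (fun i => f i != v) s) -> has_block c p (x :: y :: z :: s).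
Proof.
move=> ss xy xz yz hv.
have [|L [w [sL dL pw]]] := distinct_pairs p_pr hv; first by rewrite ss.
have szs := perm_size pw.
have sf : size (flatten [seq [:: u.1; u.2] | u <- L]) = (size L).*2.
  by elim: (L) => //= u l ->; count_lia.
rewrite size_cat sf ss sL in szs.
pose A := [set (f x + f y)%R; (f x + f z)%R; (f y + f z)%R].
have cA : #|A| = 3.
  rewrite /A -setUA cardsU1 cards2 !inE.
  have -> : (f x + f y == f y + f z)%R = false.
    by rewrite [(f x + f y)%R]addrC (inj_eq (addrI _)) (negbTE xz).
  by rewrite (inj_eq (addrI _)) (inj_eq (addIr _)) (negbTE yz) (negbTE xy).
have A0 : A != set0 by rewrite -card_gt0 cA.
have [|B [cB _ hB]] := @reach_pairs p p_pr T f L [:: x; y; z] 2 A dL A0.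
  move=> v; rewrite !inE -orbA => /or3P[] /eqP ->.
  - by exists [:: x; y], [:: z]; split; rewrite ?big_cons ?big_nil ?addr0.
  - by exists [:: x; z], [:: y]; split; rewrite ?big_cons ?big_nil ?addr0 //; perm_lia.
  - by exists [:: y; z], [:: x]; split; rewrite ?big_cons ?big_nil ?addr0 //; perm_lia.
have BT : B = setT.
  apply/eqP; rewrite eqEcard subsetT /= cardsT card_Fp //.
  by apply: leq_trans cB; rewrite cA sL; count_lia.
have /hB hz : (- \sum_(i <- w) f i)%R \in B by rewrite BT inE.
have := reach_all w hz; rewrite subrr sL => -[t [u [pt st tz]]].
exists t, u; split; first by perm_lia.
rewrite /block st dvdn_Fp // natr_sum.
by rewrite -/(f _) [X in _ && (X == _)]tz eqxx andbT; count_lia.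
Qed.

(** If three values occur, one term of each is set aside and [triple_has_block] applies, provided
    that no value keeps more than p - 2 of the other terms. *)
Lemma inverse_prime_seq s : size s = p.-1.*2 -> ~ has_block c p s ->
  exists a b, [/\ a != b %[mod p], count (cong c p a) s = p.-1
                & count (cong c p b) s = p.-1].
Proof.
move=> ss nb.
have fE i j : (f i == f j) = (c i == c j %[mod p]) by rewrite /f natr_Fp_eq.
have le v : count (fun i => f i == v) s <= p.-1.
  rewrite leqNgt; apply/negP => h; apply: nb; apply: (@count_has_block _ _ _ (val v)).
  rewrite (@eq_count _ _ (fun i => f i == v)); first count_lia.
  by move=> i /=; rewrite -natr_Fp_eq // natr_Zp.
have cnt v (l : seq T) : count (fun i => f i != v) l = size l - count (fun i => f i == v) l.
  by rewrite -(count_predC (fun i => f i == v) l) addKn.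
have [|x [s1 [sx _]]] := @has_perm_cons _ predT s; first by rewrite count_predT ss; count_lia.
case: (boolP (all (fun i => (f i == f x) || (f i == f x)) s)) => [h|].
  by apply: (@two_values_counts _ _ _ (c x) (c x)) => //; [count_lia | apply: sub_all h => i; rewrite fE].
rewrite -has_predC has_count => /has_perm_cons[y [s2 [sy]]]; rewrite /= orbb => yx.
case: (boolP (all (fun i => (f i == f x) || (f i == f y)) s)) => [h|].
  by apply: (@two_values_counts _ _ _ (c x) (c y)) => //; [count_lia | apply: sub_all h => i; rewrite !fE].
rewrite -has_predC has_count => /has_perm_cons[z [s3 [sz]]]; rewrite /= negb_or => /andP[zx zy].
have mem3 w : f w != f x -> f w != f y -> w \in s -> exists s', perm_eq s (x :: y :: w :: s').
  move=> wx wy ws; apply: (@sub_perm _ [:: x; y; w]) => i /=.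
  have xs : x \in s by rewrite (perm_mem sx) inE eqxx.
  have ys : y \in s by rewrite (perm_mem sy) inE eqxx.
  have ne j k : f j != f k -> j != k by apply: contraNneq => ->.
  have cm j : j \in s -> 0 < count_mem j s by rewrite -has_count has_pred1.
  case: (eqVneq x i) => [<-|_].
    by rewrite (negbTE (ne _ _ yx)) (negbTE (ne _ _ wx)); exact: cm.
  case: (eqVneq y i) => [<-|_]; first by rewrite (negbTE (ne _ _ wy)); exact: cm.
  by case: (eqVneq w i) => [<-|_] //; exact: cm.
have conclude w s' : f w != f x -> f w != f y -> perm_eq s (x :: y :: w :: s') ->
    (forall v, v != f x -> v != f y -> v != f w -> count (fun i => f i == v) s < p.-1) -> False.
  move=> wx wy ps' hv; apply: nb.
  have ss' : size s' = (p - 3).*2.+1 by have := perm_size ps'; rewrite /= ss; count_lia.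
  have [t [u [pt bt]]] : has_block c p (x :: y :: w :: s').
    apply: triple_has_block => //; [by rewrite eq_sym | by rewrite eq_sym | by rewrite eq_sym |].
    move=> v; rewrite cnt ss'; have := le v; have := hv v.
    rewrite !(eq_sym v) (seq.permP ps') /=.
    case: eqP => _; case: eqP => _; case: eqP => _ //=; rewrite ?add0n; count_lia.
  by exists t, u; split=> //; rewrite (perm_trans ps').
have zs : z \in s by rewrite (perm_mem sz) inE eqxx.
have [s' ps'] := mem3 _ zx zy zs.
(* A value with p - 1 terms, if there is one, is taken as the third: it then keeps p - 2 terms, and
   a second such value would not fit among the remaining 2p - 5. *)
case: (boolP [exists v, [&& v != f x, v != f y & count (fun i => f i == v) s == p.-1]]).
  case/existsP=> v /and3P[vx vy /eqP cv].
  have [|w [s4 [pw /eqP fw]]] := @has_perm_cons _ (fun i => f i == v) s; first by rewrite cv; count_lia.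
  have ws : w \in s by rewrite (perm_mem pw) inE eqxx.
  have [||s5 ps5] := mem3 w _ _ ws; rewrite ?fw //.
  exfalso; apply: (conclude w s5); rewrite ?fw // => v' v'x v'y v'w.
  have := le v'; rewrite leq_eqVlt => /orP[/eqP cv'|]; last by [].
  have : count (fun i => f i == v) s5 + count (fun i => f i == v') s5 <= size s5.
    rewrite -count_predUI [X in _ + X](@eq_count _ _ pred0) ?count_pred0 ?addn0 ?count_size //.
    by move=> i /=; apply/negP => /andP[/eqP -> /eqP e]; rewrite e eqxx in v'w.
  move: cv cv'; rewrite !(seq.permP ps5) /= fw eqxx !(eq_sym (f _)) (negbTE vx) (negbTE vy) (negbTE v'x) (negbTE v'y).
  rewrite [v == v']eq_sym (negbTE v'w); have := perm_size ps5; rewrite /= ss; count_lia.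
move/existsPn=> hv; exfalso; apply: (conclude z s') => // v vx vy _.
by have := hv v; have := le v; rewrite vx vy /=; count_lia.
Qed.

End InversePrime.

(** * The inverse theorem for a product *)

Section InverseComposite.

Variables (p n : nat) (p_pr : prime p) (p_gt2 : 2 < p) (n_gt2 : 2 < n).
Hypotheses (inv_p : inverse_egz p) (inv_n : inverse_egz n).
Variables (T : eqType) (c : T -> nat) (s : seq T).
Hypotheses (size_s : size s = (p * n).-1.*2) (no_block : ~ has_block c (p * n) s).

Let arrangement bs w :=
  [/\ perm_eq s (flatten bs ++ w), size bs = n.-1.*2 & all (block c p) bs].

(** The theorem of Erdos, Ginzburg and Ziv would apply to the values of the 2n - 1 blocks. *)
Lemma no_extra_block bs w : perm_eq s (flatten bs ++ w) -> size bs = n.*2.-1 ->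
  all (block c p) bs -> False.
Proof.
move=> sw sb ab; have en : egz n by apply: egz_gt0; count_lia.
have [|b1 [b2 [pb bb]]] := en _ (block_val c p) bs; first by rewrite sb.
apply: no_block; exists (flatten b1), (flatten b2 ++ w); split.
  by have := perm_flatten pb; rewrite flatten_cat => ?; perm_lia.
apply: flatten_block => //; first count_lia.
by move: ab; rewrite (perm_all _ pb) all_cat => /andP[].
Qed.

Lemma arrangement_values bs w : arrangement bs w ->
  exists a b, [/\ a != b %[mod n],
    count (cong (block_val c p) n a) bs = n.-1 &
    count (cong (block_val c p) n b) bs = n.-1].
Proof.
move=> [sw sb ab]; apply: inv_n => // -[b1 [b2 [pb bb]]].
apply: no_block; exists (flatten b1), (flatten b2 ++ w); split.
  by have := perm_flatten pb; rewrite flatten_cat => ?; perm_lia.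
apply: flatten_block => //; first count_lia.
by move: ab; rewrite (perm_all _ pb) all_cat => /andP[].
Qed.

Lemma arrangement_size bs w : arrangement bs w -> size w = p.-1.*2.
Proof.
move=> [sw sb ab]; have [|e _] := sum_flatten_blocks _ ab; first count_lia.
have := perm_size sw; rewrite size_cat e size_s sb; nia.
Qed.

(* Exchanging x and y changes the value of a single block, whereas before and
   after the exchange two values are taken n - 1 times each. *)
Lemma exchange_in_block bs w t e x y : arrangement bs w -> t \in bs ->
  all (cong c p e) t -> x \in t -> y \in w ->
  c y = e %[mod p] -> c x = c y %[mod p * n].
Proof.
move=> arr tbs et xt yw ye.
have sw := arrangement_size arr; have [] := arr => psw sb ab.
have [bs' pbs] := mem_perm_cons tbs.
have [t' ptt] := mem_perm_cons xt.
have [w' pww] := mem_perm_cons yw.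
have pfl : perm_eq (flatten bs) (t ++ flatten bs') by have := perm_flatten pbs.
have arr1 : arrangement (t :: bs') w.
  split; first by rewrite /=; perm_lia.
    by rewrite -sb (perm_size pbs).
  by rewrite -(perm_all _ pbs).
have bt : block c p t by apply: (allP ab).
have st : size t = p by case/andP: bt => /eqP.
have bt2 : block c p (y :: t').
  apply: (@const_block _ _ _ e); first by have := perm_size ptt; rewrite /= st.
  by move: et; rewrite (perm_all _ ptt) /= => /andP[_ ->]; rewrite ye eqxx.
have arr2 : arrangement ((y :: t') :: bs') (x :: w').
  case: arr1 => _ sb1 /= /andP[_ ab1]; split=> //=; last by rewrite bt2.
  by clear -psw ptt pww pfl; perm_lia.
have [a [b [nab ca cb]]] := arrangement_values arr1.
have [a2 [b2 [nab2 ca2 cb2]]] := arrangement_values arr2.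
have sz1 : size (t :: bs') = n.-1.*2 by case: arr1.
have sz2 : size ((y :: t') :: bs') = n.-1.*2 by case: arr2.
have h1 := count_mod_eq (e := block_val c p t) nab ca cb sz1.
have h2 := count_mod_eq (e := block_val c p t) nab2 ca2 cb2 sz2.
move: h1 h2; rewrite /= eqxx => h1 h2.
(* As n > 2, another block still has the old value of [t], so this value is again taken n - 1 times
   after the exchange. *)
have {}h1 := h1 isT; have {}h2 := h2 (ltac:(count_lia)).
have /eqP e2 : block_val c p (y :: t') == block_val c p t %[mod n] by case: (_ == _) h2 h1 => //=; count_lia.
have m l : block c p l -> \sum_(i <- l) c i = p * block_val c p l.
  by case/andP=> _ db; rewrite /block_val mulnC divnK.
have m1 := m _ bt; have m2 := m _ bt2; rewrite big_cons in m2.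
rewrite (sum_nat_perm c ptt) big_cons in m1.
apply/eqP; rewrite -(eqn_modDr (\sum_(i <- t') c i)) m1 m2.
by rewrite -!muln_modr e2.
Qed.

(** Modulo p the leftover [w] takes two values, and every block is constant with one of them.
    Exchanges between blocks and leftover then show that terms which agree modulo p agree modulo
    pn. *)
Lemma inverse_composite_seq :
  exists a b, [/\ a != b %[mod p * n], count (cong c (p * n) a) s = (p * n).-1
                & count (cong c (p * n) b) s = (p * n).-1].
Proof.
have ep : egz p by apply: egz_gt0; count_lia.
have [||bs [w [sw sb ab]]] := @egz_extract p T c s n.-1.*2 ep; [count_lia | by rewrite size_s; nia |].
have arr : arrangement bs w by [].
have szw := arrangement_size arr.
have [|u [v [uv wu wv]]] := (inv_p : forall T c s, _) T c w szw.
  move=> [b [u [pb bb]]]; apply: (@no_extra_block (b :: bs) u) => /=.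
  - by rewrite -catA; perm_lia.
  - by rewrite sb; count_lia.
  - by rewrite bb.
(* A block and the leftover form 3p - 2 terms; two disjoint blocks among them would raise the number
   of blocks to 2n - 1. *)
have types t : t \in bs -> count (cong c p u) t = p /\ count (cong c p v) t = 0
    \/ count (cong c p v) t = p /\ count (cong c p u) t = 0.
  move=> tbs; have [bs' pbs] := mem_perm_cons tbs.
  have st : size t = p by have /andP[/eqP] := allP ab _ tbs.
  have pfl : perm_eq (flatten bs) (t ++ flatten bs') by have := perm_flatten pbs.
  have [||a [b [nab ca cb]]] := @no_disjoint_blocks_counts p T c (t ++ w) (ltnW p_gt2) inv_p.
  - by rewrite size_cat st szw; count_lia.
  - move=> [t1 [t2 [x [pt b1 b2]]]]; apply: (@no_extra_block [:: t1, t2 & bs'] x) => /=.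
    + by rewrite -!catA; perm_lia.
    + by have := perm_size pbs; rewrite /= sb; count_lia.
    + by rewrite b1 b2; move: ab; rewrite (perm_all _ pbs) /= => /andP[].
  have le : size (t ++ w) <= count (cong c p a) (t ++ w) + count (cong c p b) (t ++ w).
    by rewrite ca cb size_cat st szw; count_lia.
  have hu := @two_values_mem _ _ _ _ _ u _ nab le.
  have hv := @two_values_mem _ _ _ _ _ v _ nab le.
  rewrite !count_cat wu in hu; rewrite !count_cat wv in hv; rewrite !count_cat in ca cb.
  have {}hu := hu (ltac:(count_lia)); have {}hv := hv (ltac:(count_lia)).
  case: hu => hu; case: hv => hv; try by move: uv; rewrite hu hv eqxx.
  - left; move: (count_mod_congr c w hu) (count_mod_congr c w hv).
    by move: (count_mod_congr c t hu) (count_mod_congr c t hv); count_lia.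
  - right; move: (count_mod_congr c w hu) (count_mod_congr c w hv).
    by move: (count_mod_congr c t hu) (count_mod_congr c t hv); count_lia.
have st t : t \in bs -> size t = p by move=> /(allP ab)/andP[/eqP].
have full e t : t \in bs -> count (cong c p e) t = p -> all (cong c p e) t.
  by move=> tbs ct; rewrite all_count ct st.
have [|yu [wu' [pu yuu]]] := @has_perm_cons _ (cong c p u) w; first by rewrite wu; count_lia.
have [|yv [wv' [pv yvv]]] := @has_perm_cons _ (cong c p v) w; first by rewrite wv; count_lia.
have yuw : yu \in w by rewrite (perm_mem pu) inE eqxx.
have yvw : yv \in w by rewrite (perm_mem pv) inE eqxx.
have allw : all (predU (cong c p u) (cong c p v)) w.
  by apply: two_values_all => //; rewrite wu wv szw; count_lia.
(* If all blocks had the same type, their terms would agree modulo p * n. *)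
have both e e' y : (forall t, t \in bs -> count (cong c p e) t = p \/ count (cong c p e') t = p) ->
    y \in w -> cong c p e y -> exists2 t, t \in bs & count (cong c p e') t = p.
  move=> tys yw ye; case: (boolP (has (fun t => count (cong c p e') t == p) bs)).
    by case/hasP=> t tbs /eqP; exists t.
  rewrite -all_predC => /allP hn; case: no_block; apply: (@count_has_block _ _ _ (c y)).
  rewrite (seq.permP sw) count_cat.
  have -> : count (cong c (p * n) (c y)) (flatten bs) = size (flatten bs).
    apply/eqP; rewrite -all_count; apply/allP => x /flattenP[t tbs xt] /=; apply/eqP.
    apply: (exchange_in_block arr tbs _ xt yw (eqP ye)); apply: full => //.
    by case: (tys t tbs) => // h; have := hn t tbs; rewrite /= h eqxx.
  have [|e1 _] := sum_flatten_blocks _ ab; first count_lia.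
  rewrite e1 sb; apply: leq_trans (leq_addr _ _).
  by rewrite leq_pmul2l; count_lia.
have [|tv tvbs ctv] := both u v yu _ yuw yuu.
  by move=> t /types[[]|[]]; [left | right].
have [|tu tubs ctu] := both v u yv _ yvw yvv.
  by move=> t /types[[]|[]]; [right | left].
(* Leftover terms of one class are compared with each other through a block of that class. *)
have class e t y : t \in bs -> count (cong c p e) t = p -> y \in w -> cong c p e y ->
    all (cong c (p * n) (c y)) t /\ (forall y', y' \in w -> cong c p e y' -> c y' = c y %[mod p * n]).
  move=> tbs ct yw ye; have ft := full _ _ tbs ct.
  have exch x y' xt y'w y'e := @exchange_in_block _ _ _ _ x y' arr tbs ft xt y'w y'e.
  split; first by apply/allP => x xt; apply/eqP; apply: exch => //; exact/eqP.
  move=> y' y'w y'e; have [|x [t' [ptx _]]] := @has_perm_cons _ predT t.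
    by rewrite count_predT st //; count_lia.
  have xt : x \in t by rewrite (perm_mem ptx) inE eqxx.
  by rewrite -(exch x y') -?(exch x y) //; apply/eqP.
apply: (@two_values_counts _ _ _ (c yu) (c yv)) => //; first by clear -p_gt2 n_gt2; nia.
rewrite (perm_all _ sw) all_cat; apply/andP; split.
  apply/allP => x /flattenP[t tbs xt] /=; case: (types t tbs) => [[ct _]|[ct _]].
    by have [/allP h _] := class _ _ _ tbs ct yuw yuu; rewrite [X in X || _]h.
  by have [/allP h _] := class _ _ _ tbs ct yvw yvv; rewrite [X in _ || X]h // orbT.
apply/allP => y yw /=; have /orP[yu'|yv'] := allP allw _ yw.
  by have [_ ->] := class _ _ _ tubs ctu yuw yuu; rewrite ?eqxx.
by have [_ ->] := class _ _ _ tvbs ctv yvw yvv; rewrite ?eqxx ?orbT.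
Qed.

End InverseComposite.

(** Oddness provides factors greater than 2, as the composite step requires. *)
Lemma inverse_egz_odd n : odd n -> 1 < n -> inverse_egz n.
Proof.
elim/ltn_ind: n => n IH on n1.
set p := pdiv n; have p_pr : prime p by apply: pdiv_prime.
have np : n = n %/ p * p by rewrite divnK // pdiv_dvd.
set n' := n %/ p in np; have /andP[on' op] : odd n' && odd p by rewrite -oddM -np.
have p2 : 2 < p by have := prime_gt1 p_pr; case: (p) op => [|[|[|]]].
have inv_p : inverse_egz p by move=> T c s; exact: inverse_prime_seq.
case: (ltnP 1 n') => [n'1|n'1]; last first.
  have e : n' = 1 by move: on' n'1; case: (n') => [|[|]].
  by rewrite np e mul1n.
have n'2 : 2 < n' by case: (n') on' n'1 => [|[|[|]]].
rewrite np mulnC => T c s; apply: inverse_composite_seq => //.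
by apply: IH => //; nia.
Qed.

(** * The symmetric group of degree three *)

(* [(b, r)] stands for x^b y^r, where x y = y^-1 x and x^2 = y^3 = 1. *)
Definition D3 : Type := (bool * 'Z_3)%type.
HB.instance Definition _ := Finite.on D3.

Definition D3_mul (g h : D3) : D3 :=
  (g.1 (+) h.1, ((if h.1 then - g.2 else g.2) + h.2)%R).
Definition D3_inv (g : D3) : D3 := (g.1, if g.1 then g.2 else (- g.2)%R).

Fact D3_mulA : associative D3_mul.
Proof.
move=> [a r] [b q] [c t]; rewrite /D3_mul /= addbA; congr pair.
by case: b; case: c => /=; rewrite ?opprD ?opprK ?addrA.
Qed.
Fact D3_mul1 : left_id (false, 0%R : 'Z_3) D3_mul.
Proof. by move=> [[] r]; rewrite /D3_mul /= ?oppr0 add0r. Qed.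
Fact D3_1mul : right_id (false, 0%R : 'Z_3) D3_mul.
Proof. by move=> [[] r]; rewrite /D3_mul /= addr0. Qed.
Fact D3_mulV : left_inverse (false, 0%R : 'Z_3) D3_inv D3_mul.
Proof. by move=> [[] r]; rewrite /D3_mul /= addNr. Qed.
Fact D3_Vmul : right_inverse (false, 0%R : 'Z_3) D3_inv D3_mul.
Proof. by move=> [[] r]; rewrite /D3_mul /= ?addNr ?addrN. Qed.

HB.instance Definition _ :=
  isGroup.Build D3 D3_mulA D3_mul1 D3_1mul D3_mulV D3_Vmul.

Definition D3_elts : seq D3 :=
  [seq (b, r) | b <- [:: false; true], r <- [:: 0; 1; -1]%R : seq 'Z_3].

Lemma mem_D3_elts (g : D3) : g \in D3_elts.
Proof. by case: g => [[] [[|[|[|]]] ?]]. Qed.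

Lemma D3_all (P : pred D3) : all P D3_elts -> forall g, P g.
Proof. by move=> /allP h g; apply: h; exact: mem_D3_elts. Qed.

Section D3Sequences.

Variables (T : eqType) (D : T -> D3).
Implicit Types (s t : seq T).

Definition odd_elt (i : T) : bool := (D i).1.
Definition has_one_product s := exists2 l, perm_eq l s & (\prod_(i <- l) D i = 1)%g.

Lemma prod_parity s : (\prod_(i <- s) D i)%g.1 = odd (count odd_elt s).
Proof.
elim: s => [|x s IH]; first by rewrite big_nil.
by rewrite big_cons /= oddD -IH /odd_elt; case: (D x).1.
Qed.

(** All labels lie in the subgroup of order two generated by [(true, r)], so parity decides. *)
Lemma homogeneous_product (r : 'Z_3) s :
  all (fun i => (D i).2 == if (D i).1 then r else 0%R) s ->
  ~~ odd (count odd_elt s) -> (\prod_(i <- s) D i = 1)%g.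
Proof.
move=> hs; suff -> : (\prod_(i <- s) D i)%g
    = if odd (count odd_elt s) then (true, r) else 1%g :> D3 by case: odd.
elim: s hs => [|x s IH] /=; first by rewrite big_nil.
case/andP=> /eqP hx /IH e; rewrite big_cons e oddD /odd_elt.
by case: (D x) hx => -[] q /= ->; case: odd;
  rewrite ?mulg1 ?mul1g // /mul /= /D3_mul /= ?addNr ?oppr0 ?add0r.
Qed.

(* Such a core absorbs any even product: its terms can be arranged so as to
   give every element of the rotation subgroup. *)
Definition core s := forall w : D3, ~~ w.1 ->
  exists2 l, perm_eq l s & ((\prod_(i <- l) D i) * w = 1)%g.

(** Moving [u] or [v] across the reflection [a] reverses its sign, and the four signed sums of two
    nonzero elements exhaust Z/3. *)
Lemma core_rotations a b u v : (D a).1 -> (D b).1 -> ~~ (D u).1 -> ~~ (D v).1 ->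
  (D u).2 != 0%R -> (D v).2 != 0%R -> core [:: a; b; u; v].
Proof.
move=> ha hb hu hv hu0 hv0 w hw.
have /or4P : [|| (D a * D u * D v * D b * w == 1)%g, (D u * D a * D v * D b * w == 1)%g,
    (D v * D a * D u * D b * w == 1)%g | (D u * D v * D a * D b * w == 1)%g].
  move: (D a) (D b) (D u) (D v) w ha hb hu hv hu0 hv0 hw.
  pose P (a b u v w : D3) := [&& a.1, b.1, ~~ u.1, ~~ v.1, u.2 != 0%R, v.2 != 0%R & ~~ w.1] ==>
    [|| (a * u * v * b * w == 1)%g, (u * a * v * b * w == 1)%g,
    (v * a * u * b * w == 1)%g | (u * v * a * b * w == 1)%g].
  have hP : all (fun a => all (fun b => all (fun u => all (fun v => all (P a b u v) D3_elts)
    D3_elts) D3_elts) D3_elts) D3_elts by vm_compute.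
  move=> a' b' u' v' w' ha hb hu hv hu0 hv0 hw.
  have := D3_all (D3_all (D3_all (D3_all (D3_all hP a') b') u') v') w'.
  by rewrite /P ha hb hu hv hu0 hv0 hw.
case=> /eqP e; [exists [:: a; u; v; b] | exists [:: u; a; v; b] | exists [:: v; a; u; b]
  | exists [:: u; v; a; b]]; try perm_lia; by rewrite !big_cons big_nil mulg1 !mulgA.
Qed.

(** The orders aabb, abab and baba give the identity, a rotation of order three and its inverse. *)
Lemma core_reflections a a' b b' : (D a).1 -> (D b).1 -> D a = D a' -> D b = D b' ->
  D a != D b -> core [:: a; a'; b; b'].
Proof.
move=> ha hb ea eb ab w hw.
have /or3P : [|| (D a * D a * D b * D b * w == 1)%g, (D a * D b * D a * D b * w == 1)%g
    | (D b * D a * D b * D a * w == 1)%g].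
  move: (D a) (D b) w ha hb ab hw {ea eb}.
  pose P (a b w : D3) := [&& a.1, b.1, a != b & ~~ w.1] ==>
    [|| (a * a * b * b * w == 1)%g, (a * b * a * b * w == 1)%g | (b * a * b * a * w == 1)%g].
  have hP : all (fun a => all (fun b => all (P a b) D3_elts) D3_elts) D3_elts by vm_compute.
  move=> a1 b1 w1 ha hb ab hw; have := D3_all (D3_all (D3_all hP a1) b1) w1.
  by rewrite /P ha hb ab hw.
case=> /eqP e; [exists [:: a; a'; b; b'] | exists [:: a; b; a'; b'] | exists [:: b; a; b'; a']];
  try perm_lia; by rewrite !big_cons big_nil mulg1 !mulgA -ea -eb.
Qed.

Lemma core_has_one_product s t : core s -> ~~ odd (count odd_elt t) -> has_one_product (s ++ t).
Proof.
move=> cs; rewrite -prod_parity => /cs[l ls e]; exists (l ++ t); first by rewrite perm_cat2r.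
by rewrite big_cat.
Qed.

End D3Sequences.

(** * The Gao constant of S3, by enumeration of the multisets of size nine *)

(** Multisets of size [n] over [k] elements, encoded by their multiplicities. *)
Fixpoint vecs (k n : nat) : seq (seq nat) :=
  if k is k'.+1 then flatten [seq [seq i :: v | v <- vecs k' (n - i)] | i <- iota 0 n.+1]
  else if n == 0 then [:: [::]] else [::].

Lemma mem_vecs k n v : size v = k -> sumn v = n -> v \in vecs k n.
Proof.
elim: k n v => [|k IH] n [|i v] //; first by move=> _ /= <-.
move=> [sv] <-.
have -> : vecs k.+1 (sumn (i :: v)) = flatten [seq [seq j :: w | w <- vecs k (sumn (i :: v) - j)]
  | j <- iota 0 (sumn (i :: v)).+1] by [].
apply/flattenP; exists [seq i :: w | w <- vecs k (sumn (i :: v) - i)].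
  by apply: (map_f (fun j => [seq j :: w | w <- vecs k (_ - j)])); rewrite mem_iota /= ltnS leq_addr.
by rewrite map_f // IH // /= addKn.
Qed.

(** Depth-first search for an ordering with product one, built from the last factor backwards; the
    empty list stands for failure. *)
Fixpoint one_word (k : nat) (v : seq nat) (g : D3) (w : seq D3) : seq D3 :=
  if k is k'.+1 then
    (fix try_all (l : seq nat) : seq D3 := if l is i :: l' then
       if 0 < nth 0 v i then
         let r := one_word k' (set_nth 0 v i (nth 0 v i).-1)
                    (D3_mul (nth (false, 0%R) D3_elts i) g)
                    (nth (false, 0%R : 'Z_3) D3_elts i :: w) in
         if r is [::] then try_all l' else r
       else try_all l'
     else [::]) (iota 0 6)
  else if g == (false, 0%R) then w else [::].

Definition D3_counts (l : seq D3) : seq nat := [seq count_mem g l | g <- D3_elts].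

Definition one_words : seq (seq D3) :=
  [seq w <- [seq one_word 6 v (false, 0%R) [::] | v <- vecs 6 6] | w != [::]].

(** Each word found is checked afterwards, so nothing has to be proved about the search. *)
Definition D3_words_ok : bool :=
  all (fun w => (size w == 6) && (foldr D3_mul (false, 0%R) w == (false, 0%R))) one_words.

Definition contains_word (cs : seq (seq nat)) (v : seq nat) : bool :=
  has (fun w => all2 leq w v) cs.

Lemma D3_words_okT : D3_words_ok.
Proof. by vm_compute. Qed.

Lemma D3_cover9 : all (contains_word [seq D3_counts w | w <- one_words]) (vecs 6 9).
Proof. by vm_compute. Qed.

(** In the order of [D3_elts] the first three multiplicities belong to rotations and the last three
    to reflections. *)
Lemma D3_cover8 : all (fun v => contains_word [seq D3_counts w | w <- one_words] (v ++ [:: 0; 0; 0])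
  && contains_word [seq D3_counts w | w <- one_words] ([:: 0; 0; 0] ++ v)) (vecs 3 8).
Proof. by vm_compute. Qed.

Lemma sumn_D3_counts l : sumn (D3_counts l) = size l.
Proof.
elim: l => [|x l IH]; first by vm_compute.
have /eqP e1 : sumn [seq nat_of_bool (x == g) | g <- D3_elts] == 1.
  by move: x; apply: D3_all; vm_compute.
rewrite -[size _]/(size l).+1 -IH /D3_counts; move: e1; rewrite !sumnE !big_map => e1.
by rewrite -[in RHS]add1n -{1}e1 -big_split.
Qed.

Lemma contains_word_sub l : contains_word [seq D3_counts w | w <- one_words] (D3_counts l) ->
  exists t u, [/\ perm_eq l (t ++ u), size t = 6 & (\prod_(g <- t) g = 1 :> D3)%g].
Proof.
case/hasP=> _ /mapP[w wW ->] le_wl.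
have /andP[/eqP sw /eqP pw] := allP D3_words_okT _ wW.
have le : all (fun g => count_mem g w <= count_mem g l) D3_elts.
  by move: le_wl; rewrite /D3_counts; elim: D3_elts => //= g gs IH /andP[-> /IH].
have [u wu] := sub_perm (fun g => allP le g (mem_D3_elts g)).
by exists w, u; split=> //; rewrite -foldrE.
Qed.

Lemma D3_sub9 l : size l = 9 ->
  exists t u, [/\ perm_eq l (t ++ u), size t = 6 & (\prod_(g <- t) g = 1 :> D3)%g].
Proof.
move=> sl; apply: contains_word_sub; apply: (allP D3_cover9); apply: mem_vecs => //.
by rewrite sumn_D3_counts.
Qed.

Lemma D3_sub8 l (b : bool) : size l = 8 -> all (fun g : D3 => g.1 == b) l ->
  exists t u, [/\ perm_eq l (t ++ u), size t = 6 & (\prod_(g <- t) g = 1 :> D3)%g].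
Proof.
move=> sl /allP lb; apply: contains_word_sub.
have c0 g : g.1 != b -> count_mem g l = 0.
  by move=> gb; apply/count_memPn; apply: contra gb => /lb.
pose v := take 3 (D3_counts l); pose w := drop 3 (D3_counts l).
have cE : D3_counts l = v ++ w by rewrite cat_take_drop.
have sE : sumn v + sumn w = 8 by rewrite -sumn_cat -cE sumn_D3_counts.
case: b c0 {lb} => c0.
  have e : v = [:: 0; 0; 0] by rewrite /v /= !c0.
  have /(allP D3_cover8)/andP[_ h] : w \in vecs 3 8 by apply: mem_vecs; rewrite -?sE ?e.
  by rewrite cE e.
have e : w = [:: 0; 0; 0] by rewrite /w /= !c0.
have /(allP D3_cover8)/andP[h _] : v \in vecs 3 8 by apply: mem_vecs; rewrite -?sE ?e ?addn0.
by rewrite cE e.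
Qed.

(** This transfers the enumeration over S3 itself to lists that merely carry labels in S3. *)
Lemma perm_map_lift (T U : eqType) (f : T -> U) s l : perm_eq (map f s) l ->
  exists2 s', perm_eq s s' & map f s' = l.
Proof.
elim: l s => [|y l IH] s pl.
  by exists [::] => //; move/perm_nilP: pl; case: s.
have : y \in map f s by rewrite (perm_mem pl) inE eqxx.
case/mapP=> x xs ey; have [s1 ps1] := mem_perm_cons xs.
have [s2 ps2 <-] : exists2 s', perm_eq s1 s' & map f s' = l.
  apply: IH; rewrite -(perm_cons y) -(permPr pl) ey -/(map f (x :: s1)) perm_sym.
  exact: perm_map.
by exists (x :: s2); rewrite ?ey // (permPl ps1) perm_cons.
Qed.

Definition has_one_sub (T : eqType) (D : T -> D3) k s :=
  exists t u, [/\ perm_eq s (t ++ u), size t = k & (\prod_(i <- t) D i = 1)%g].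

Lemma has_one_sub_map (T : eqType) (D : T -> D3) k s :
  has_one_sub id k (map D s) -> has_one_sub D k s.
Proof.
move=> [l1 [l2 [pl sl1 l1p]]]; have [s' ps' es'] := perm_map_lift pl.
have e1 : map D (take k s') = l1 by rewrite map_take es' take_size_cat.
exists (take k s'), (drop k s'); rewrite cat_take_drop; split=> //.
  by rewrite -(size_map D) e1.
by rewrite -[RHS]l1p -e1 big_map.
Qed.

(** Six terms are removed at a time; the excess [k] is never consumed, so it is paid only once. *)
Lemma has_one_sub_iter (T : eqType) (D : T -> D3) (a : pred T) k j s :
  (forall l, all a l -> size l = 6 + k -> has_one_sub D 6 l) ->
  all a s -> 6 * j + k <= size s -> has_one_sub D (6 * j) s.
Proof.
move=> ha; elim: j s => [|j IH] s as_ hs; first by exists [::], s; rewrite big_nil.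
have h1 : perm_eq s (take (6 + k) s ++ drop (6 + k) s) by rewrite cat_take_drop.
have [||t1 [u1 [pt1 st1 t1p]]] := ha (take (6 + k) s).
- by apply/allP => i /mem_take /(allP as_).
- by rewrite size_takel; lia.
have pu : perm_eq s (t1 ++ (u1 ++ drop (6 + k) s)) by perm_lia.
have [||t [u [pt tj tp]]] := IH (u1 ++ drop (6 + k) s).
- by move: as_; rewrite (perm_all _ pu) all_cat => /andP[].
- by have := perm_size pu; rewrite size_cat; lia.
exists (t1 ++ t), u; split; [perm_lia | rewrite size_cat; lia |].
by rewrite big_cat /= tp mulg1.
Qed.

Lemma D3_extract (T : eqType) (D : T -> D3) j s : 6 * j + 3 <= size s ->
  has_one_sub D (6 * j) s.
Proof.
apply: (@has_one_sub_iter _ _ predT); last exact: all_predT.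
by move=> l _ sl; apply: has_one_sub_map; apply: D3_sub9; rewrite size_map.
Qed.

Lemma D3_extract_class (T : eqType) (D : T -> D3) (b : bool) j s : 6 * j + 2 <= size s ->
  all (fun i => (D i).1 == b) s -> has_one_sub D (6 * j) s.
Proof.
move=> hs bs; apply: (@has_one_sub_iter _ _ (fun i => (D i).1 == b)) hs => // l bl sl.
by apply: has_one_sub_map; apply: (@D3_sub8 _ b); rewrite ?size_map ?all_map.
Qed.

(** * Sequences with at least two reflections *)

Section Good.

Variables (T : eqType) (D : T -> D3) (c : T -> nat).
Implicit Types (s t u : seq T).

(** A product-one subsequence of length [k] in S3 x Z/n. *)
Definition good (n k : nat) s : Prop :=
  exists t u, [/\ perm_eq s (t ++ u), size t = k, (\prod_(i <- t) D i = 1)%g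
                & n %| \sum_(i <- t) c i].

Lemma good_sub n k s s1 s2 : perm_eq s (s1 ++ s2) -> good n k s1 -> good n k s.
Proof. by move=> ps [t [u [pt st pr dv]]]; exists t, (u ++ s2); split=> //; perm_lia. Qed.

Lemma prod_rotations s : all (fun i => ~~ odd_elt D i) s ->
  (\prod_(i <- s) D i)%g = (false, \sum_(i <- s) (D i).2)%R.
Proof.
elim: s => [|x s IH] /=; first by rewrite !big_nil.
case/andP=> hx /IH e; rewrite !big_cons e; move: hx; rewrite /odd_elt.
by case: (D x) => -[].
Qed.

End Good.

Definition gao_reflections (n : nat) : Prop :=
  forall (T : eqType) (D : T -> D3) (c : T -> nat) (s : seq T), size s = 9 * n - 1 ->
  1 < count (odd_elt D) s -> good D c n (6 * n) s.

(** * At least two reflections: from n to pn *)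

Section CompositeStep.

Variables (p n : nat) (p_pr : prime p) (p_gt4 : 4 < p) (n_gt1 : 1 < n) (n_co3 : coprime 3 n).
Hypothesis gao_n : gao_reflections n.
Variables (T : eqType) (D : T -> D3) (c : T -> nat) (s : seq T).
Hypothesis size_s : size s = 9 * (p * n) - 1.

Let odd_p : odd p.
Proof. by case: (even_prime p_pr) => // p2; move: p_gt4; rewrite p2. Qed.

(** Besides the two blocks there are (9n - 2)p - 1 terms, exactly enough for 9n - 3 more blocks; as
    single terms, [b1] and [b2] are the two reflections that [gao_n] asks for. *)
Lemma two_odd_blocks b1 b2 u : perm_eq s (b1 ++ b2 ++ u) -> block c p b1 -> block c p b2 ->
  odd (count (odd_elt D) b1) -> odd (count (odd_elt D) b2) -> good D c (p * n) (6 * (p * n)) s.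
Proof.
move=> ps bb1 bb2 o1 o2.
have sb b : block c p b -> size b = p by case/andP=> /eqP.
have p0 : 0 < p by lia.
have [|bs [w [pu sbs abs]]] := @egz_extract p T c u (9 * n - 3) (egz_gt0 p0) p0.
  by have := perm_size ps; rewrite !size_cat (sb _ bb1) (sb _ bb2) size_s; clear -n_gt1 p0; nia.
pose D' b := (\prod_(i <- b) D i)%g.
have [||t [v [pt st prt dvt]]] := @gao_n (seq T) D' (block_val c p) [:: b1, b2 & bs].
- by rewrite /= sbs; lia.
- by rewrite /= /odd_elt /D' !prod_parity o1 o2.
have ab : all (block c p) t.
  have : all (block c p) [:: b1, b2 & bs] by rewrite /= bb1 bb2.
  by rewrite (perm_all _ pt) all_cat => /andP[].
have [sft eft] := sum_flatten_blocks p0 ab.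
exists (flatten t), (flatten v ++ w); split.
- have := perm_flatten pt; rewrite flatten_cat /= => pf.
  by clear -ps pu pf; move: pf; rewrite catA => pf; perm_lia.
- by rewrite sft st mulnCA.
- by rewrite big_flatten.
- by rewrite eft dvdn_pmul2l.
Qed.

(** Blocks made of reflections alone are odd because their length p is. *)
Lemma many_reflections : 3 * p - 1 <= count (odd_elt D) s -> good D c (p * n) (6 * (p * n)) s.
Proof.
move=> hk; have p0 : 0 < p by lia.
have [|bs [w [pw sbs abs]]] := @egz_extract p T c (filter (odd_elt D) s) 2 (egz_gt0 p0) p0.
  by rewrite size_filter; lia.
case: bs sbs abs pw => [|b1 [|b2 [|]]] // _ /and3P[bb1 bb2 _] /= pw.
have pf : perm_eq s (filter (odd_elt D) s ++ filter (predC (odd_elt D)) s).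
  by rewrite perm_sym perm_filterC.
rewrite cats0 -catA in pw.
have : all (odd_elt D) (b1 ++ b2 ++ w) by rewrite -(perm_all _ pw); exact: filter_all.
rewrite !all_cat => /and3P[ob1 ob2 _].
have co b : block c p b -> all (odd_elt D) b -> odd (count (odd_elt D) b).
  by move=> /andP[/eqP sb _]; rewrite all_count => /eqP ->; rewrite sb.
apply: (@two_odd_blocks b1 b2 (w ++ filter (predC (odd_elt D)) s)) => //; rewrite ?co //.
by clear -pw pf; perm_lia.
Qed.

(** Over 6pn terms the common residue contributes a multiple of pn. It remains to cancel the
    quotients by p modulo n and the rotations modulo 3, a zero-sum problem modulo 3n solved by 2p
    blocks of length 3n. *)
Lemma frequent_rotation a :
  6 * (p * n) + 3 * n - 1 <= count (predI (predC (odd_elt D)) (cong c p a)) s ->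
  good D c (p * n) (6 * (p * n)) s.
Proof.
move=> /count_split[X [Y [pX sX aX]]]; apply: good_sub pX _.
pose e i := chinese 3 n (val (D i).2) (c i %/ p).
have n30 : 0 < 3 * n by lia.
have [|bs [w [pw sbs abs]]] := @egz_extract (3 * n) T e X (2 * p) (egz_gt0 n30) n30.
  by rewrite sX; nia.
have [sf ef] := sum_flatten_blocks n30 abs.
set t := flatten bs in sf ef pw *.
have at_ : all (predI (predC (odd_elt D)) (cong c p a)) t.
  by move: aX; rewrite (perm_all _ pw) all_cat => /andP[].
exists t, w; split=> //.
- by rewrite sf sbs; lia.
- rewrite prod_rotations; last by apply: sub_all at_ => i /andP[].
  have -> : (\sum_(i <- t) (D i).2 = (\sum_(i <- t) e i)%:R :> 'Z_3)%R.
    rewrite natr_sum; apply: eq_bigr => i _; apply/val_inj => /=.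
    by rewrite val_Zp_nat // /e chinese_modl // modn_small //; exact: (ltn_ord (D i).2).
  rewrite ef -mulnA natrM.
  have e3 : (3%:R = 0 :> 'Z_3)%R by apply/val_inj.
  by rewrite e3 mul0r.
have es : \sum_(i <- t) c i = p * \sum_(i <- t) (c i %/ p) + size t * (a %% p).
  move: at_; elim: (t) => [|x l IH] /=; first by rewrite !big_nil muln0.
  case/andP=> /andP[_ /eqP cx] /IH e1; rewrite !big_cons e1 {1}(divn_eq (c x) p) cx; lia.
have ne : n %| \sum_(i <- t) e i by rewrite ef -mulnA; apply/dvdn_mull/dvdn_mulr.
have mc : \sum_(i <- t) (c i %/ p) = \sum_(i <- t) e i %[mod n].
  elim: (t) => [|x l IH]; first by rewrite !big_nil.
  by rewrite !big_cons -modnDm IH -[in RHS]modnDm /e chinese_modr.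
rewrite es; apply: dvdn_add.
  by rewrite dvdn_pmul2l; [rewrite /dvdn mc | lia].
rewrite sf sbs; apply/dvdnP; exists (6 * (a %% p)); move: (a %% p) => q.
by clear; nia.
Qed.

(** Two families of p - 1 pairs of rotations with distinct residues each complete one reflection to
    a block, which is therefore odd. *)
Lemma diverse_rotations : 1 < count (odd_elt D) s ->
  (forall v : 'F_p, p.-1.*2 <= count (fun i => ((c i)%:R != v)%R) (filter (predC (odd_elt D)) s)) ->
  p.-1.*2.*2 <= count (predC (odd_elt D)) s -> good D c (p * n) (6 * (p * n)) s.
Proof.
move=> hk hv hr; pose f i : 'F_p := ((c i)%:R)%R.
have [|L [w [sL dL pL]]] := @distinct_pairs p p_pr T f _ _ hv; first by rewrite size_filter.
pose L1 := take p.-1 L; pose L2 := drop p.-1 L.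
have sL1 : size L1 = p.-1 by rewrite size_takel; lia.
have sL2 : size L2 = p.-1 by rewrite size_drop; lia.
have [d1 d2] : all (fun u => f u.1 != f u.2) L1 /\ all (fun u => f u.1 != f u.2) L2.
  by move: dL; rewrite -{1}(cat_take_drop p.-1 L) all_cat => /andP[].
have [t [u [pt st at_]]] := count_split hk.
case: t st at_ pt => [|g [|h [|]]] //= _ /and3P[og oh _] pt.
have pf : perm_eq s (filter (odd_elt D) s ++ filter (predC (odd_elt D)) s).
  by rewrite perm_sym perm_filterC.
have pu : perm_eq u (filter (odd_elt D) u ++ filter (predC (odd_elt D)) u).
  by rewrite perm_sym perm_filterC.
have pr : perm_eq (filter (predC (odd_elt D)) s) (filter (predC (odd_elt D)) u).
  by rewrite (permPl (perm_filter _ pt)) /= og oh.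
have block_of x l : odd_elt D x -> all (fun u => f u.1 != f u.2) l -> size l = p.-1 ->
    {subset l <= L} -> exists t v, [/\ perm_eq (flatten [seq [:: u.1; u.2] | u <- l]) (t ++ v),
      block c p (x :: t) & odd (count (odd_elt D) (x :: t))].
  move=> ox dl sl lL; have [t [v [ptv stv zt]]] := reach_pairs_full p_pr (- f x)%R dl sl.
  exists t, v; split=> //.
    rewrite /block -[size _]/(size t).+1 stv prednK ?(prime_gt0 p_pr) // eqxx andTb.
    by rewrite dvdn_Fp // big_cons natrD natr_sum -/(f _) [X in (_ + X)%R]zt subrr.
  rewrite /= ox (eqP (_ : count (odd_elt D) t == 0)) // -leqn0 leqNgt -has_count.
  apply/hasPn => y yt; suff : y \in filter (predC (odd_elt D)) s by rewrite mem_filter => /andP[].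
  rewrite (perm_mem pL) mem_cat; apply/orP; left.
  have : y \in flatten [seq [:: u.1; u.2] | u <- l] by rewrite (perm_mem ptv) mem_cat yt.
  case/flattenP=> _ /mapP[e /lL eL ->] ye; apply/flattenP.
  by exists [:: e.1; e.2] => //; apply: map_f.
have [|t1 [v1 [pt1 b1 o1]]] := block_of g L1 og d1 sL1; first by move=> y /mem_take.
have [|t2 [v2 [pt2 b2 o2]]] := block_of h L2 oh d2 sL2; first by move=> y /mem_drop.
apply: (@two_odd_blocks (g :: t1) (h :: t2) (v1 ++ v2 ++ w ++ filter (odd_elt D) u)) => //.
move: pL; rewrite -[in X in perm_eq _ X](cat_take_drop p.-1 L) map_cat flatten_cat -/L1 -/L2 => pL.
by clear -pt pu pr pt1 pt2 pL; perm_lia.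
Qed.

End CompositeStep.

Lemma gao_reflections_mul p n : prime p -> 4 < p -> 1 < n -> coprime 3 n ->
  gao_reflections n -> gao_reflections (p * n).
Proof.
move=> p_pr p4 n1 n3 gao_n T D c s ss hk.
case: (leqP (3 * p - 1) (count (odd_elt D) s)) => [|k3].
  exact: many_reflections.
pose r := filter (predC (odd_elt D)) s; pose f i : 'F_p := ((c i)%:R)%R.
have sr : size r = count (predC (odd_elt D)) s by rewrite size_filter.
have := count_predC (odd_elt D) s; rewrite ss -sr => kr.
case: (boolP [exists v : 'F_p, count (fun i => f i != v) r < p.-1.*2]).
  case/existsP=> v hv; apply: (frequent_rotation p_pr p4 n1 n3 ss (a := val v)).
  have := count_predC (fun i => f i == v) r.
  have -> : count (predI (predC (odd_elt D)) (cong c p (val v))) s = count (fun i => f i == v) r.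
    rewrite count_filter; apply: eq_count => i /=; rewrite andbC; congr (_ && _).
    by rewrite -natr_Fp_eq // natr_Zp.
  rewrite [count (predC _) r](eq_count (a2 := fun i => f i != v)) //.
  (* At least 9pn - 5p + 4 terms remain, and the bound reduces to (3p - 3)n >= 5p - 5, which n > 1
     ensures. *)
  clear -hv k3 kr n1 p4; nia.
move/existsPn=> hv; apply: diverse_rotations => //.
  by move=> v; have := hv v; rewrite -leqNgt.
rewrite -sr; clear -k3 kr n1 p4; nia.
Qed.

Definition unpair (T : Type) (L : seq (T * T)) : seq T :=
  flatten [seq [:: u.1; u.2] | u <- L].
Arguments unpair : simpl never.

Lemma unpair_cons (T : Type) (u : T * T) L : unpair (u :: L) = [:: u.1, u.2 & unpair L].
Proof. by []. Qed.

Lemma unpair_cat (T : Type) (L L' : seq (T * T)) : unpair (L ++ L') = unpair L ++ unpair L'.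
Proof. by rewrite /unpair map_cat flatten_cat. Qed.

Lemma size_unpair (T : Type) (L : seq (T * T)) : size (unpair L) = (size L).*2.
Proof. by elim: L => // u L IH; rewrite unpair_cons /= IH. Qed.

Lemma perm_unpair (T : eqType) (L L' : seq (T * T)) :
  perm_eq L L' -> perm_eq (unpair L) (unpair L').
Proof. by move=> pL; apply/perm_flatten/perm_map. Qed.

(** * At least two reflections: the case of a prime p > 4 *)

Section PrimeBase.

Variables (p : nat) (p_pr : prime p) (p_gt4 : 4 < p).
Variables (T : eqType) (D : T -> D3) (c : T -> nat).
Let f i : 'F_p := ((c i)%:R)%R.
Let par := odd_elt D.

Let odd_p : odd p.
Proof. by case: (even_prime p_pr) => // p2; move: p_gt4; rewrite p2. Qed.

(* Membership in the subgroup generated by the reflection [(true, r)] and the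
   centre; that subgroup is cyclic of order 2p. *)
Definition homogeneous_elt (r : 'Z_3) : pred T := fun i => (D i).2 == if (D i).1 then r else 0%R.

(** In a cyclic group of order 2p, three blocks of length 2p exist among 8p - 1 terms. *)
Lemma few_outside_good s r : size s = 9 * p - 1 -> count (predC (homogeneous_elt r)) s <= p ->
  good D c p (6 * p) s.
Proof.
move=> ss hr; have [|X [Y [pX sX aX]]] := @count_split _ (homogeneous_elt r) s (8 * p - 1).
  by have := count_predC (homogeneous_elt r) s; rewrite ss; lia.
(* As p is odd, [e i] is congruent to the parity modulo 2 and to [c i] modulo p. *)
apply: good_sub pX _; pose e i := p * par i + p.+1 * c i.
have p20 : 0 < 2 * p by lia.
have [|bs [w [pw sbs abs]]] := @egz_extract (2 * p) T e X 3 (egz_gt0 p20) p20.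
  by rewrite sX; lia.
have [sf ef] := sum_flatten_blocks p20 abs.
set t := flatten bs in sf ef pw *.
have es : \sum_(i <- t) e i = p * count par t + p.+1 * \sum_(i <- t) c i.
  elim: (t) => [|x l IH]; first by rewrite !big_nil !muln0.
  by rewrite !big_cons IH /e /=; move: (par x) => b; clear; nia.
have d2 : 2 * p %| p * count par t + p.+1 * \sum_(i <- t) c i by rewrite -es ef dvdn_mulr.
exists t, w; split=> //; first by rewrite sf sbs; lia.
  apply: (@homogeneous_product _ _ r).
    by move: aX; rewrite (perm_all _ pw) all_cat => /andP[].
  have : 2 %| p * count par t + p.+1 * \sum_(i <- t) c i by apply: dvdn_trans d2; exact: dvdn_mulr.
  by rewrite dvdn2 oddD !oddM /= odd_p /= addbF.
have : p %| p * count par t + p.+1 * \sum_(i <- t) c i by apply: dvdn_trans d2; exact: dvdn_mull.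
rewrite dvdn_addr; last exact: dvdn_mulr.
by rewrite mulSn dvdn_addl // dvdn_mulr.
Qed.

Let refl (r : 'Z_3) : pred T := fun i => D i == (true, r).
Let nontriv : pred T := fun i => ~~ par i && ((D i).2 != 0%R).

Lemma outside_count s (r : 'Z_3) :
  count (predC (homogeneous_elt r)) s = count nontriv s + (count (refl (r + 1)%R) s + count (refl (r + 1 + 1)%R) s).
Proof.
elim: s => //= x s ->; suff : (~~ homogeneous_elt r x : nat) = nontriv x + (refl (r + 1)%R x + refl (r + 1 + 1)%R x).
  by clear; lia.
rewrite /homogeneous_elt /nontriv /refl /par /odd_elt.
move: (D x) => d; apply/eqP.
pose P (g h : D3) := ((g.2 != (if g.1 then h.2 else 0%R)) : nat) ==
  (~~ g.1 && (g.2 != 0%R)) + ((g == (true, h.2 + 1)%R) + (g == (true, h.2 + 1 + 1)%R)).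
have hP : all (fun g => all (P g) D3_elts) D3_elts by vm_compute.
exact: (D3_all (D3_all hP d) (true, r)).
Qed.

(** With at most one nontrivial rotation, two of the three reflections of S3 occur twice; otherwise
    at most three terms would lie outside the subgroup belonging to the remaining one. *)
Lemma exists_core s : 1 < count par s -> (forall r, p < count (predC (homogeneous_elt r)) s) ->
  exists k s', [/\ perm_eq s (k ++ s'), size k = 4 & core D k].
Proof.
move=> hk hr; case: (ltnP 1 (count nontriv s)) => hN.
  have [t [u [pt st at_]]] := count_split hk.
  have ct : count nontriv t = 0.
    apply/eqP; rewrite -leqn0 leqNgt -has_count; apply/hasPn => i it.
    by rewrite /nontriv (allP at_ _ it).
  have : 1 < count nontriv u by move: hN; rewrite (seq.permP pt) count_cat ct.
  move=> /count_split[t2 [v [pt2 st2 at2]]].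
  case: t st at_ pt {ct} => [|a [|b [|]]] //= _ /and3P[oa ob _] pt.
  case: t2 st2 at2 pt2 => [|x [|y [|]]] //= _ /and3P[/andP[ox nx] /andP[oy ny] _] pt2.
  exists [:: a; b; x; y], v; split=> //.
  - by perm_lia.
  - exact: core_rotations.
have [r [q [rq hr2 hq2]]] : exists r q, [/\ r != q, 1 < count (refl r) s & 1 < count (refl q) s].
  have := hr 0%R; have := hr 1%R; have := hr (1 + 1)%R; rewrite !outside_count.
  have n01 : (0 != 1 :> 'Z_3)%R by vm_compute.
  have n02 : (0 != 1 + 1 :> 'Z_3)%R by vm_compute.
  have n12 : (1 != 1 + 1 :> 'Z_3)%R by vm_compute.
  have e3 : (1 + 1 + 1 = 0 :> 'Z_3)%R by apply/val_inj.
  rewrite !add0r !e3 !add0r => h1 h2 h3.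
  case: (ltnP 1 (count (refl 0%R) s)) => c0; case: (ltnP 1 (count (refl 1%R) s)) => c1;
    case: (ltnP 1 (count (refl (1 + 1)%R) s)) => c2.
  all: try (exfalso; move: h1 h2 h3 c0 c1 c2 hN;
    move: (count (refl 0%R) s) (count (refl 1%R) s) (count (refl (1 + 1)%R) s) (count nontriv s);
    by clear -p_gt4; lia).
  all: try by exists 0%R, 1%R.
  all: try by exists 0%R, (1 + 1)%R.
  by exists 1%R, (1 + 1)%R.
have [t [u [pt st at_]]] := count_split hr2.
have ct : count (refl q) t = 0.
  apply/eqP; rewrite -leqn0 leqNgt -has_count; apply/hasPn => i it.
  by rewrite /refl (eqP (allP at_ _ it)) xpair_eqE /= (negbTE rq).
have : 1 < count (refl q) u by move: hq2; rewrite (seq.permP pt) count_cat ct.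
move=> /count_split[t2 [v [pt2 st2 at2]]].
case: t st at_ pt {ct} => [|a [|b [|]]] //= _ /and3P[/eqP ha /eqP hb _] pt.
case: t2 st2 at2 pt2 => [|x [|y [|]]] //= _ /and3P[/eqP hx /eqP hy _] pt2.
exists [:: a; b; x; y], v; split=> //.
- by perm_lia.
- by apply: core_reflections; rewrite ?ha ?hb ?hx ?hy //= xpair_eqE /= rq.
Qed.

(** A sum of 6p equal labels vanishes modulo p, so only S3 matters. *)
Lemma const_label_good s (h : 'F_p) : all (fun i => f i == h) s ->
  has_one_sub D (6 * p) s -> good D c p (6 * p) s.
Proof.
move=> hs [t [u [pt st prt]]]; exists t, u; split=> //; rewrite dvdn_Fp // natr_sum.
have : all (fun i => f i == h) t by move: hs; rewrite (perm_all _ pt) all_cat => /andP[].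
move=> /allP ht; rewrite (eq_big_seq (fun=> h)); last by move=> i /ht /eqP.
rewrite big_const_seq count_predT st iter_addr_0 -mulr_natr natrM.
by rewrite pchar_Fp_0 // !mulr0.
Qed.

Lemma frequent_label_good s (h : 'F_p) : 6 * p + 3 <= count (fun i => f i == h) s ->
  good D c p (6 * p) s.
Proof.
move=> /count_split[X [Y [pX sX aX]]]; apply: good_sub pX (const_label_good aX _).
by apply: D3_extract; rewrite sX.
Qed.

Lemma frequent_class_good s (h : 'F_p) (b : bool) :
  6 * p + 2 <= count (fun i => (f i == h) && (par i == b)) s -> good D c p (6 * p) s.
Proof.
move=> /count_split[X [Y [pX sX aX]]]; apply: good_sub pX (@const_label_good X h _ _).
  by apply: sub_all aX => i /andP[].
by apply: (@D3_extract_class _ D b); [rewrite sX | apply: sub_all aX => i /andP[]].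
Qed.

Let lab (u : T * T) : 'F_p := (f u.1 + f u.2)%R.
Let same_par (u : T * T) : bool := par u.1 == par u.2.

Lemma even_unpair L : all same_par L -> ~~ odd (count par (unpair L)).
Proof.
elim: L => [|u L IH]; first by [].
rewrite unpair_cons => /andP[/eqP e /IH]; rewrite /= e !oddD.
by case: (par u.2) => /=; case: odd.
Qed.

Lemma count_unpair (a : pred T) v L :
  all (fun u => (lab u == v) ==> a u.1 && a u.2) L ->
  2 * count (fun u => lab u == v) L <= count a (unpair L).
Proof.
elim: L => [|u L IH]; first by [].
rewrite unpair_cons => /andP[/implyP hu /IH] /=.
by case: (lab u == v) hu => [/(_ isT)/andP[-> ->]|_] /=; clear; lia.
Qed.

(** Equal parity within pairs makes every union of pairs even, as a core requires of its
    complement. *)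
Definition pairing (s : seq T) L w : Prop :=
  [/\ perm_eq s (unpair L ++ w), all same_par L, count par w <= 1 & count (predC par) w <= 1].

Lemma exists_pairing s : exists L w, pairing s L w.
Proof.
have pair_up b n r : size r <= n -> all (fun i => par i == b) r ->
    exists L w, [/\ perm_eq r (unpair L ++ w), all same_par L, size w <= 1 & all (fun i => par i == b) w].
  elim: n r => [|n IH] [|x [|y r]] //= sr ar.
  - by exists [::], [::].
  - by exists [::], [::].
  - by exists [::], [:: x].
  case/and3P: ar => hx hy hr; have [|L [w [pL aL sw aw]]] := IH r _ hr; first by clear -sr; lia.
  exists ((x, y) :: L), w; split=> //; first by rewrite unpair_cons !perm_cons.
  by rewrite /= aL /same_par /= (eqP hx) (eqP hy) eqxx.
have [||L1 [w1 [p1 a1 s1 b1]]] := pair_up true (size s) (filter par s).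
- by rewrite size_filter count_size.
- by apply/allP => i; rewrite mem_filter => /andP[->].
have [||L2 [w2 [p2 a2 s2 b2]]] := pair_up false (size s) (filter (predC par) s).
- by rewrite size_filter count_size.
- by apply/allP => i; rewrite mem_filter => /andP[/negbTE /= ->].
have c1 : count (predC par) w1 = 0.
  by apply/eqP; rewrite -leqn0 leqNgt -has_count; apply/hasPn => i /(allP b1)/eqP /= ->.
have c2 : count par w2 = 0.
  by apply/eqP; rewrite -leqn0 leqNgt -has_count; apply/hasPn => i /(allP b2)/eqP /= ->.
have pf : perm_eq s (filter par s ++ filter (predC par) s) by rewrite perm_sym perm_filterC.
exists (L1 ++ L2), (w1 ++ w2); split.
- by rewrite unpair_cat; clear -p1 p2 pf; perm_lia.
- by rewrite all_cat a1.
- by rewrite count_cat c2 addn0 (leq_trans (count_size _ _)).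
- by rewrite count_cat c1 add0n (leq_trans (count_size _ _)).
Qed.

(** * Pairings of the terms outside a core *)

Section Pairing.

Variables (k s : seq T).
Hypotheses (size_k : size k = 4) (core_k : core D k).
Hypothesis size_s : size s = 9 * p - 5.

(** As p is odd, 9p - 5 is even, so the leftover is empty or has one term of each parity. *)
Lemma pairing_size L w : pairing s L w ->
  (size L).*2 + size w = 9 * p - 5 /\ (size w = 0 \/ size w = 2).
Proof.
move=> [pw _ w1 w2]; have := perm_size pw; rewrite size_cat size_unpair size_s => e.
have := count_predC par w; have := odd_double_half p; rewrite odd_p; move: w1 w2 e; clear; lia.
Qed.

(** The core and 3p - 2 pairs make 6p terms; the pairs are chosen to cancel the labels of the core,
    which then absorbs their product in S3. *)
Lemma diverse_pairing_good L w : pairing s L w ->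
  (forall v, p.-1 <= count (fun u => lab u != v) L) -> good D c p (6 * p) (k ++ s).
Proof.
move=> pL hv; have [szL szw] := pairing_size pL; have [pw aL _ _] := pL.
have [|t [u [pt st zt]]] := @reach_subsums p p_pr _ lab L (3 * p - 2) hv _ (- \sum_(i <- k) f i)%R.
  by move: szL szw; move: (size L) (size w) => a b; clear -p_gt4; lia.
have at_ : all same_par t by move: aL; rewrite (perm_all _ pt) all_cat => /andP[].
have [l pl l1] := core_has_one_product core_k (even_unpair at_).
have pf : perm_eq (unpair L) (unpair t ++ unpair u).
  by have := perm_unpair pt; rewrite unpair_cat.
exists l, (unpair u ++ w); split=> //.
- by clear -pw pl pf; perm_lia.
- by rewrite (perm_size pl) size_cat size_k size_unpair st; clear -p_gt4; lia.
rewrite (sum_nat_perm c pl) dvdn_Fp // natr_sum big_cat /= -/(f _).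
have -> : (\sum_(i <- unpair t) (c i)%:R = \sum_(u <- t) lab u :> 'F_p)%R.
  elim: (t) => [|x l' IH]; first by rewrite !big_nil.
  by rewrite unpair_cons !big_cons IH addrA.
by rewrite zt subrr.
Qed.

(* A pair with label v whose terms differ can be rearranged with another pair of
   label v, or with a leftover term, into pairs with other labels.  When this is
   no longer possible, almost all terms have label v / 2. *)
Lemma concentrated_pairing_good m L w v : pairing s L w ->
  count (fun u => lab u == v) L <= m -> count (fun u => lab u != v) L <= p - 2 ->
  good D c p (6 * p) (k ++ s).
Proof.
have cnt L' v' : count (fun u => lab u == v') L' + count (fun u => lab u != v') L' = size L'.
  by rewrite -(count_predC (fun u => lab u == v') L').
elim: m L w => [|m IH] L w pL hm hp.
  exfalso; have [szL szw] := pairing_size pL; move: (cnt L v) hm hp szL szw; clear -p_gt4; lia.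
have [szL szw] := pairing_size pL; have [pw aL w1 w2] := pL.
have cL := cnt L v.
have goods : good D c p (6 * p) s -> good D c p (6 * p) (k ++ s).
  by apply: good_sub; rewrite perm_catC.
(* An exchange creates one or two more pairs with labels other than [v]; once there are p - 1 of
   these, the labels are diverse. *)
have improve L2 w2' : pairing s L2 w2' -> size L2 = size L ->
    count (fun u => lab u != v) L < count (fun u => lab u != v) L2 <=
    (count (fun u => lab u != v) L).+2 -> good D c p (6 * p) (k ++ s).
  move=> pL2 s2 hc; have cL2 := cnt L2 v.
  case: (leqP (count (fun u => lab u != v) L2) (p - 2)) => h2.
    by apply: (IH L2 w2') => //; move: cL cL2 hm hc s2; clear; lia.
  apply: (diverse_pairing_good pL2) => v'; case: (eqVneq v' v) => [->|v'v].
    by move: h2; clear -p_gt4; lia.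
  apply: (@leq_trans (count (fun u => lab u == v) L2)).
    by move: cL cL2 hc s2 hp szL szw; clear -p_gt4; lia.
  by apply: sub_count => u /= /eqP ->; rewrite eq_sym.
(* The labels of a regrouping sum to 2v, so both or neither equal [v]. If first terms paired
   together give [v], the crossed regrouping has the labels 2 [f u.1] and 2 [f u.2], which differ
   from [v]. *)
have two u u' L' : perm_eq L [:: u, u' & L'] -> lab u = v -> lab u' = v ->
    f u.1 != f u.2 -> par u.1 = par u'.1 -> good D c p (6 * p) (k ++ s).
  move=> pu lu lu' fu pu'.
  have /= /and3P[/eqP su /eqP su' aL'] : all same_par [:: u, u' & L'] by rewrite -(perm_all _ pu).
  have pf := perm_unpair pu; have sL' := perm_size pu.
  have cL' := seq.permP pu (fun u => lab u != v); rewrite /= lu lu' eqxx /= !add0n in cL'.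
  case: (eqVneq (lab (u.1, u'.1)) v) => [e|ne].
    have e1 : f u'.1 = f u.2 by apply: (@addrI _ (f u.1)); exact: etrans e (esym lu).
    have e2 : f u'.2 = f u.1 by apply: (@addrI _ (f u'.1)); rewrite -[LHS]/(lab u') lu' -lu e1 addrC.
    have n1 : lab (u.1, u'.2) != v by rewrite -lu /lab /= e2 (inj_eq (addrI _)).
    have n2 : lab (u.2, u'.1) != v by rewrite -lu /lab /= e1 (inj_eq (addIr _)) eq_sym.
    apply: (@improve [:: (u.1, u'.2), (u.2, u'.1) & L'] w).
    - split=> //; first by clear -pw pf; rewrite !unpair_cons in pf *; perm_lia.
      by rewrite /= aL' /same_par /= -su' -su -pu' eqxx.
    - by rewrite sL'.
    - by rewrite /= n1 n2 cL'; clear; lia.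
  have n2 : lab (u.2, u'.2) != v.
    apply: contra ne => /eqP e; apply/eqP.
    apply: (@addIr _ (lab (u.2, u'.2))); rewrite [LHS]addrACA -/(lab u) -/(lab u') lu lu' e //.
  apply: (@improve [:: (u.1, u'.1), (u.2, u'.2) & L'] w).
  - split=> //; first by clear -pw pf; rewrite !unpair_cons in pf *; perm_lia.
    by rewrite /= aL' /same_par /= -su' -su -pu' eqxx.
  - by rewrite sL'.
  - by rewrite /= ne n2 cL'; clear; lia.
have leftover u L' x y l w' : perm_eq L (u :: L') -> lab u = v ->
    perm_eq [:: u.1; u.2] [:: x; y] -> par l = par u.1 -> perm_eq w (l :: w') ->
    lab (x, l) != v -> good D c p (6 * p) (k ++ s).
  move=> pu lu pxy pl pww' ne.
  have /= /andP[/eqP su aL'] : all same_par (u :: L') by rewrite -(perm_all _ pu).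
  have [px py] : par x = par u.1 /\ par y = par u.1.
    have : all (fun i => par i == par u.1) [:: x; y] by rewrite -(perm_all _ pxy) /= -su eqxx.
    by case/and3P=> /eqP ? /eqP.
  have cw a := seq.permP pww' a; rewrite /= in cw.
  have pf := perm_unpair pu; have sL' := perm_size pu.
  have cL' := seq.permP pu (fun u => lab u != v); rewrite /= lu eqxx /= !add0n in cL'.
  apply: (@improve ((x, l) :: L') (y :: w')).
  - split.
    + by clear -pw pf pxy pww'; rewrite !unpair_cons in pf *; perm_lia.
    + by rewrite /= aL' /same_par /= px pl eqxx.
    + by move: w1; rewrite cw /= py pl.
    + by move: w2; rewrite cw /= py pl.
  - by rewrite sL'.
  - by rewrite /= ne cL'; clear; lia.
have has_left b : size w = 2 -> exists l w', perm_eq w (l :: w') /\ par l = b.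
  move=> s2; have [|l [w' [pw' /eqP pl]]] := @has_perm_cons _ (fun i => par i == b) w.
    have := count_predC par w; rewrite s2; case: b => e.
      rewrite (eq_count (a2 := par)); last by move=> i; case: (par i).
      by move: e w1 w2; clear; lia.
    rewrite (eq_count (a2 := predC par)); last by move=> i /=; case: (par i).
    by move: e w1 w2; clear; lia.
  by exists l, w'.
pose h : 'F_p := (v / 2%:R)%R.
have two0 : (2%:R != 0 :> 'F_p)%R.
  by rewrite -dvdn_Fp //; apply/negP => /dvdn_leq; move/(_ isT); clear -p_gt4; lia.
have half (u : T * T) : lab u = v -> f u.1 = f u.2 -> f u.1 = h.
  move=> lu e; apply: (mulIf two0); rewrite divfK // -lu /lab -e mulr_natr mulr2n //.
case: (boolP (has (fun u => (lab u == v) && (f u.1 != f u.2)) L)) => [|nhalf].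
  case/hasP=> u uL /andP[/eqP lu fu]; have [L' pu] := mem_perm_cons uL.
  case: (boolP (has (fun u' => (lab u' == v) && (par u.1 == par u'.1)) L')) => [|nsame].
    case/hasP=> u' u'L /andP[/eqP lu' /eqP e]; have [L2 pu2] := mem_perm_cons u'L.
    apply: (two u u' L2) => //; rewrite (permPl pu) perm_cons //.
  case: szw => szw; last first.
    have [l [w' [pww pl]]] := has_left (par u.1) szw.
    (* The terms of [u] have distinct labels, so [l] gives a label other than [v] with at least one
       of them. *)
    case: (eqVneq (lab (u.1, l)) v) => [e|ne].
      have el : f l = f u.2 by apply: (@addrI _ (f u.1)); exact: etrans e (esym lu).
      apply: (leftover u L' u.2 u.1 l w') => //; first by perm_lia.
      by rewrite -lu /lab /= el (inj_eq (addIr _)) eq_sym.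
    by apply: (leftover u L' u.1 u.2 l w').
  have cL' := seq.permP pu (fun u => lab u == v); rewrite /= lu eqxx in cL'.
  case: (boolP (has (fun u => (lab u == v) && (f u.1 != f u.2)) L')) => [|nhalf].
    case/hasP=> u' u'L /andP[/eqP lu' fu']; have [L2 pu2] := mem_perm_cons u'L.
    have cL2 := seq.permP pu2 (fun u => lab u == v); rewrite /= lu' eqxx in cL2.
    (* A third pair with label [v] has, like [u'], the parity opposite to [u], so these two can be
       regrouped. *)
    have [|u3 [L3 [pu3 /eqP lu3]]] := @has_perm_cons _ (fun u => lab u == v) L2.
      have : 2 < count (fun u => lab u == v) L by move: cL hp szL szw; clear -p_gt4; lia.
      by rewrite cL' cL2.
    have nsame' x : x \in L' -> lab x = v -> par u.1 != par x.1.
      by move=> xL lx; have := hasPn nsame _ xL; rewrite lx eqxx.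
    have u3L : u3 \in L' by rewrite (perm_mem pu2) inE (perm_mem pu3) inE eqxx orbT.
    apply: (two u' u3 (u :: L3)) => //.
      by clear -pu pu2 pu3; perm_lia.
    have := nsame' _ u3L lu3; have := nsame' _ u'L lu'.
    by case: (par u.1); case: (par u'.1); case: (par u3.1).
  (* All other pairs with label [v] consist of terms with label [h] and the parity opposite to [u].
     They provide at least 7p - 3 terms, which for p = 5 is exactly 6p + 2. *)
  apply/goods/(@frequent_class_good s h (~~ par u.1)).
  have pf := perm_unpair pu.
  apply: leq_trans (_ : count (fun i => (f i == h) && (par i == ~~ par u.1)) (unpair L') <= _); last first.
    by rewrite (seq.permP pw) count_cat (seq.permP pf) unpair_cons /=; clear; lia.
  apply: leq_trans (count_unpair (v := v) _).
    by move: cL' cL hp szL szw; clear -p_gt4; lia.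
  apply/allP => u' u'L; apply/implyP => /eqP lu'.
  have := hasPn nsame _ u'L; have := hasPn nhalf _ u'L.
  rewrite lu' eqxx /= negbK => /eqP e ne.
  have /eqP su' : same_par u' by apply: (allP aL); rewrite (perm_mem pu) inE u'L orbT.
  rewrite -e (half _ lu' e) eqxx -su' /=.
  by move: ne; case: (par u.1); case: (par u'.1).
have cf : 2 * count (fun u => lab u == v) L <= count (fun i => f i == h) (unpair L).
  apply: count_unpair; apply/allP => u uL; apply/implyP => /eqP lu.
  have := hasPn nhalf _ uL; rewrite lu eqxx /= negbK => /eqP e.
  by rewrite -e (half _ lu e) eqxx.
case: szw => szw.
  apply/goods/(@frequent_label_good s h).
  rewrite (seq.permP pw) count_cat; move: cf cL hp szL szw; clear -p_gt4; lia.
have c1 : 0 < count (fun u => lab u == v) L by move: cL hp szL szw; clear -p_gt4; lia.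
have [u [L' [pu /eqP lu]]] := has_perm_cons c1.
have uL : u \in L by rewrite (perm_mem pu) inE eqxx.
have eu : f u.1 = f u.2.
  by have := hasPn nhalf _ uL; rewrite lu eqxx /= negbK => /eqP.
have [l [w' [pww pl]]] := has_left (par u.1) szw.
(* The pairs provide 7p - 3 terms with label [h]; a leftover term with this label makes 7p - 2,
   which for p = 5 is exactly 6p + 3. *)
case: (eqVneq (f l) h) => [e|ne].
  apply/goods/(@frequent_label_good s h).
  rewrite (seq.permP pw) count_cat (seq.permP pww) /= e eqxx.
  by move: cf cL hp szL szw; clear -p_gt4; lia.
apply: (leftover u L' u.1 u.2 l w') => //.
by rewrite -lu /lab /= (inj_eq (addrI _)) -eu (half _ lu eu).
Qed.

End Pairing.

End PrimeBase.

Lemma gao_reflections_prime p : prime p -> 4 < p -> gao_reflections p.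
Proof.
move=> p_pr p4 T D c s ss hk.
case: (boolP [exists r, count (predC (homogeneous_elt D r)) s <= p]).
  by case/existsP=> r; exact: few_outside_good.
move/existsPn=> hr.
have [|k [s' [pk sk ck]]] := @exists_core p p4 T D s hk.
  by move=> r; rewrite ltnNge.
have ss' : size s' = 9 * p - 5.
  by have := perm_size pk; rewrite size_cat ss sk; lia.
suff gk : good D c p (6 * p) (k ++ s').
  by apply: (good_sub (s2 := [::]) _ gk); rewrite cats0.
have [L [w pL]] := exists_pairing D s'.
pose lab (u : T * T) : 'F_p := ((c u.1)%:R + (c u.2)%:R)%R.
case: (boolP [exists v, count (fun u => lab u != v) L <= p - 2]).
  case/existsP=> v hv.
  exact: (concentrated_pairing_good p_pr p4 sk ck ss' pL (leqnn _) hv).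
move/existsPn=> hv; apply: (diverse_pairing_good p_pr p4 sk ck ss' pL) => v.
by have := hv v; rewrite -ltnNge; apply: leq_trans; clear -p4; lia.
Qed.

Lemma gao_reflections_coprime6 n : 1 < n -> coprime 6 n -> gao_reflections n.
Proof.
elim/ltn_ind: n => n IH n1 n6.
set p := pdiv n; have p_pr : prime p by apply: pdiv_prime.
have np : n = p * (n %/ p) by rewrite mulnC divnK // pdiv_dvd.
set n' := n %/ p in np.
have p6 : coprime 6 p by apply: coprime_dvdr n6; exact: pdiv_dvd.
have n'6 : coprime 6 n' by apply: coprime_dvdr n6; rewrite np dvdn_mull.
have p4 : 4 < p by move: (prime_gt1 p_pr) p6; case: (p) => [|[|[|[|[|]]]]].
have gp : gao_reflections p by exact: gao_reflections_prime.
case: (ltnP 1 n') => [n'1|n'1]; last first.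
  have n'0 : 0 < n' by case: (n') np n1 => // ->; rewrite muln0.
  by have -> : n = p by rewrite np (_ : n' = 1) ?muln1 //; clear -n'1 n'0; lia.
rewrite np; apply: gao_reflections_mul => //; last by apply: IH => //; rewrite np; nia.
exact: coprime_dvdl n'6.
Qed.

(** * Coordinates on the group *)

Section MultiplicativeMaps.

Variables (G H : groupType) (f : {multiplicative G -> H}).

Lemma mult_map1 : f 1%g = 1%g.
Proof. by apply: (@mulgI _ (f 1%g)); rewrite -gmulfM !mulg1. Qed.

Lemma mult_mapV g : f (g^-1)%g = ((f g)^-1)%g.
Proof. by apply: (@mulgI _ (f g)); rewrite -gmulfM !mulgV mult_map1. Qed.

Lemma mult_mapX g k : f (g ^+ k)%g = (f g ^+ k)%g.
Proof. by elim: k => [|k IH]; rewrite ?mult_map1 // !expgS gmulfM IH. Qed.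

Lemma mult_map_expgz g z : f (expgz g z) = expgz (f g) z.
Proof. by case: z => k; rewrite /expgz ?mult_mapV mult_mapX. Qed.

Lemma mult_map_prod (s : seq G) : f (\prod_(g <- s) g)%g = (\prod_(g <- s) f g)%g.
Proof.
by elim: s => [|g s IH]; rewrite ?big_nil ?mult_map1 // !big_cons gmulfM IH.
Qed.

End MultiplicativeMaps.

Lemma expg_rot k : (((false, 1%R) : D3) ^+ k)%g = (false, k%:R%R).
Proof.
elim: k => [|k IH] //; rewrite expgS IH.
by rewrite mulrS.
Qed.

Lemma expgz_rot z : expgz ((false, 1%R) : D3) z = (false, z%:~R%R).
Proof. by case: z => k; rewrite /expgz expg_rot. Qed.

Lemma expg_refl i : (((true, 0%R) : D3) ^+ i)%g = (odd i, 0%R).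
Proof. by elim: i => // i IH; rewrite expgS IH /=; case: (odd i); apply/eqP; vm_compute. Qed.

Lemma expg_Zp n k : ((1%R : 'Z_n) ^+ k)%g = k%:R%R.
Proof. by elim: k => [|k IH] //; rewrite expgS IH mulrS. Qed.

Lemma expgz_Zp n z : expgz (1%R : 'Z_n) z = z%:~R%R.
Proof. by case: z => k; rewrite /expgz expg_Zp. Qed.

Lemma natr_Zp_eq0 m k : 1 < m -> ((k%:R : 'Z_m)%R == 0%R) = (m %| k).
Proof. by move=> m1; rewrite -val_eqE /= val_Zp_nat. Qed.

Lemma intr_Zp_eq0 m z : 1 < m -> ((z%:~R : 'Z_m)%R == 0%R) = (m %| z)%Z.
Proof.
move=> m1; case: z => k; first by rewrite natr_Zp_eq0.
by rewrite NegzE mulrNz oppr_eq0 dvdzE abszN natr_Zp_eq0.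
Qed.

Lemma intr_Zp_eq m z t : 1 < m -> (z = t %[mod m%:Z])%Z -> (z%:~R = t%:~R :> 'Z_m)%R.
Proof.
move=> m1 /eqP; rewrite eqz_mod_dvd -intr_Zp_eq0 // rmorphB subr_eq0.
by move/eqP.
Qed.

Lemma D3_rels n s : (s = -1 %[mod 3])%Z ->
  semidirect_rels (3 * n) s ((false, 1%R) : D3) ((true, 0%R) : D3).
Proof.
move=> s3; split; first by apply/eqP; vm_compute.
  rewrite expg_rot; congr pair; apply/eqP.
  by rewrite (@natr_Zp_eq0 3) // dvdn_mulr.
by rewrite expgz_rot (@intr_Zp_eq 3 s (-1)) //; apply/eqP; vm_compute.
Qed.

Lemma Zp_rels n s : 1 < n -> (s = 1 %[mod n%:Z])%Z ->
  semidirect_rels (3 * n) s (1%R : 'Z_n) (0%R : 'Z_n).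
Proof.
move=> n1 sn; split; first by rewrite expg1n.
  by rewrite expg_Zp; apply/eqP; rewrite natr_Zp_eq0 // dvdn_mull.
by rewrite expgz_Zp (@intr_Zp_eq n s 1) // [LHS]mulg1 [RHS]mul1g.
Qed.

(** * Subsequences of multisets *)

Definition has_one_subseq (gT : finGroupType) (s : seq gT) k : Prop :=
  exists t u, [/\ perm_eq s (t ++ u), size t = k & (\prod_(g <- t) g = 1)%g].

Lemma has_product_one_subseqE (gT : finGroupType) (S : {mset gT}%mset) k :
  has_product_one_subseq S k <-> has_one_subseq (S : seq gT) k.
Proof.
split=> [[T [TS sT [l lT l1]]]|[t [u [st tk t1]]]].
  exists l, (S `\` T)%mset; split=> //; last by rewrite (perm_size lT).
  apply/allP => g _ /=; apply/eqP; rewrite count_cat (seq.permP lT) !count_mem_mset msetE2.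
  by rewrite subnKC //; apply/msubsetP.
exists (seq_mset t); split.
- apply/msubsetP => g; rewrite mset_seqE -count_mem_mset (seq.permP st) count_cat.
  exact: leq_addr.
- by rewrite (perm_size (perm_eq_seq_mset t)).
- by exists t => //; rewrite perm_sym perm_eq_seq_mset.
Qed.

Lemma has_one_subseq_sub (gT : finGroupType) (s s1 s2 : seq gT) k :
  perm_eq s (s1 ++ s2) -> has_one_subseq s1 k -> has_one_subseq s k.
Proof. by move=> ps [t [u [pt st t1]]]; exists t, (u ++ s2); split=> //; perm_lia. Qed.

Lemma mset_of_perm (gT : finGroupType) (S : {mset gT}%mset) i j (a b e : gT) :
  perm_eq (S : seq gT) (nseq i a ++ nseq j b ++ [:: e]) <->
  S = (msetn i a `+` msetn j b `+` [mset e])%mset.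
Proof.
have cnt g : count_mem g (nseq i a ++ nseq j b ++ [:: e])
    = (msetn i a `+` msetn j b `+` [mset e])%mset g.
  rewrite !msetE2 !msetnE !count_cat !count_nseq /= !(eq_sym g) addn0.
  by case: (a == g); case: (b == g); case: (e == g) => /=; lia.
split=> [pS|->].
  by apply/msetP => g; rewrite -count_mem_mset (seq.permP pS) cnt.
by apply/allP => g _ /=; rewrite count_mem_mset cnt.
Qed.

(** * Coordinates in S3 x Z/n, the upper bound and the extremal shape *)

Section Coordinates.

Variables (n : nat) (s : int) (gT : finGroupType) (x y : gT).
Hypotheses (n_gt1 : 1 < n) (n_co6 : coprime 6 n).
Hypothesis gen_xy : <<[set y; x]>>%g = [set: gT].
Hypothesis rels : semidirect_rels (3 * n) s y x.
Variables (F1 : {multiplicative gT -> D3}) (F2 : {multiplicative gT -> 'Z_n}).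
Hypotheses (F1y : F1 y = (false, 1%R)) (F1x : F1 x = (true, 0%R)).
Hypotheses (F2y : F2 y = 1%R) (F2x : F2 x = 0%R).

Let co3 : coprime 3 n. Proof. exact: coprime_dvdl n_co6. Qed.

Lemma normal_form g : exists i j, g = (x ^+ i * y ^+ j)%g.
Proof.
have [x2 ym yx] := rels.
have nyx : x \in 'N(<[y]>)%g.
  rewrite inE -cycleJ cycle_subG conjgE mulgA -[(x^-1 * y * x)%g]mulgA yx mulgA mulVg mul1g.
  by case: (s) => k; rewrite /expgz ?groupV mem_cycle.
have : g \in (<[x]> <*> <[y]>)%g.
  have : <<[set y; x]>>%g \subset (<[x]> <*> <[y]>)%g.
    rewrite gen_subG subUset !sub1set; apply/andP; split; apply: mem_gen; rewrite inE.
      by rewrite cycle_id orbT.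
    by rewrite cycle_id.
  by move/subsetP; apply; rewrite gen_xy inE.
rewrite norm_joinEl; last by rewrite cycle_subG.
by case/mulsgP=> a b /cycleP[i ->] /cycleP[j ->] ->; exists i, j.
Qed.

(** The coordinates of x^i y^j determine i modulo 2 and j modulo 3 and n, hence modulo 3n by
    coprimality. *)
Lemma coordinates_eq1 g : F1 g = 1%g -> F2 g = 1%g -> g = 1%g.
Proof.
have [i [j ->]] := normal_form g; have [x2 ym _] := rels.
rewrite !gmulfM !mult_mapX F1x F1y F2x F2y expg_refl expg_rot expg_Zp.
rewrite expg1n mul1g => e1; have oi := congr1 fst e1; have j3 := congr1 snd e1.
move=> /eqP; rewrite natr_Zp_eq0 // => jn.
have {}oi : odd i = false by exact: etrans (esym (addbF _)) oi.
have {}j3 : 3 %| j by rewrite -(@natr_Zp_eq0 3) //; apply/eqP; exact: etrans (esym (add0r _)) j3.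
have /dvdnP[q ->] : 3 * n %| j by rewrite Gauss_dvd // j3.
by rewrite mulnC expgM ym expg1n mulg1 -(odd_double_half i) oi add0n -mul2n expgM x2 expg1n.
Qed.

Lemma coordinates_inj g h : F1 g = F1 h -> F2 g = F2 h -> g = h.
Proof.
move=> e1 e2; apply: (@mulIg _ (h^-1)%g); rewrite mulgV.
by apply: coordinates_eq1; rewrite gmulfM mult_mapV ?e1 ?e2 mulgV.
Qed.

Definition exponent (g : gT) : nat := chinese 3 n (val (F1 g).2) (val (F2 g)).

Lemma exponent_F1 g : ((exponent g)%:R = (F1 g).2)%R.
Proof.
apply/val_inj => /=; rewrite val_Zp_nat // /exponent chinese_modl // modn_small //.
exact: (ltn_ord (F1 g).2).
Qed.

Lemma exponent_F2 g : ((exponent g)%:R = F2 g)%R.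
Proof.
apply/val_inj => /=; rewrite val_Zp_nat // /exponent chinese_modr // modn_small //.
by rewrite -[X in _ < X](Zp_cast n_gt1); exact: (ltn_ord (F2 g)).
Qed.

Lemma exponentE g : g = ((if odd_elt F1 g then x else 1) * y ^+ exponent g)%g.
Proof.
apply: coordinates_inj; rewrite gmulfM mult_mapX.
  rewrite F1y expg_rot exponent_F1 /odd_elt.
  by case: (F1 g) => -[] r /=; rewrite ?F1x ?mult_map1 //; congr pair; rewrite /= ?addr0 add0r.
rewrite F2y expg_Zp exponent_F2.
by case: ifP => _; rewrite ?F2x ?mult_map1 [RHS]mul1g.
Qed.

Lemma card_gT : #|gT| = 6 * n.
Proof.
pose f g : D3 * 'Z_n := (F1 g, F2 g).
pose h (d : D3 * 'Z_n) : gT := ((if d.1.1 then x else 1) * y ^+ chinese 3 n (val d.1.2) (val d.2))%g.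
have fh : cancel f h by move=> g; rewrite /h /f /= -exponentE.
have hf : cancel h f.
  move=> [[b r] e]; rewrite /f /h /= !gmulfM !mult_mapX F1y F2y expg_rot expg_Zp.
  have -> : ((chinese 3 n r e)%:R = r :> 'Z_3)%R.
    by apply/val_inj; rewrite /= val_Zp_nat // chinese_modl // modn_small // (ltn_ord r).
  have -> : ((chinese 3 n r e)%:R = e :> 'Z_n)%R.
    apply/val_inj; rewrite /= val_Zp_nat // chinese_modr // modn_small //.
    by rewrite -[X in _ < X](Zp_cast n_gt1) (ltn_ord e).
  congr pair; case: b; rewrite ?F1x ?F2x ?mult_map1; try exact: mul1g.
  by rewrite -[LHS]/((true, (0 + r)%R) : D3) add0r.
have -> := bij_eq_card (Bijective fh hf).
by rewrite !card_prod card_bool !card_ord (Zp_cast n_gt1).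
Qed.

Lemma rotations_prod1 t : all (predC (odd_elt F1)) t -> 3 * n %| \sum_(g <- t) exponent g ->
  (\prod_(g <- t) g = 1)%g.
Proof.
have [_ ym _] := rels; move=> rt /dvdnP[q e].
suff -> : (\prod_(g <- t) g = y ^+ (\sum_(g <- t) exponent g))%g.
  by rewrite e mulnC expgM ym expg1n.
elim: t rt {e} => [|g t IH] /=; first by rewrite !big_nil.
case/andP=> rg /IH e; rewrite !big_cons e expgD; congr (_ * _)%g.
by rewrite {1}(exponentE g) (negbTE rg) mul1g.
Qed.

Lemma coordinates_prod1 t : (\prod_(g <- t) F1 g = 1)%g -> n %| \sum_(g <- t) val (F2 g) ->
  (\prod_(g <- t) g = 1)%g.
Proof.
move=> t1 t2; apply: coordinates_inj; rewrite mult_map_prod mult_map1 //.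
have -> : (\prod_(g <- t) F2 g)%g = ((\sum_(g <- t) val (F2 g))%:R)%R.
  elim: t {t1 t2} => [|g t IH]; first by rewrite !big_nil.
  by rewrite !big_cons IH natrD natr_Zp.
by apply/eqP; rewrite natr_Zp_eq0.
Qed.

Let m_gt0 : 0 < 3 * n. Proof. by rewrite muln_gt0 /= ltnW. Qed.

(** Without reflections, 3 (3n) - 1 rotations contain two disjoint blocks of length 3n; otherwise
    there are at least two reflections. *)
Lemma not_one_reflection r : size r = 9 * n - 1 -> count (odd_elt F1) r != 1 ->
  has_one_subseq r (6 * n).
Proof.
move=> sr; case: (ltngtP (count (odd_elt F1) r) 1) => // k1 _.
  have rr : all (predC (odd_elt F1)) r by rewrite all_predC has_count; lia.
  have [|bs [w [pw sbs abs]]] := @egz_extract (3 * n) _ exponent r 2 (egz_gt0 m_gt0) m_gt0.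
    by rewrite sr; lia.
  have [sf ef] := sum_flatten_blocks m_gt0 abs.
  exists (flatten bs), w; split=> //; first by rewrite sf sbs; lia.
  apply: rotations_prod1; last by rewrite ef dvdn_mulr.
  by move: rr; rewrite (perm_all _ pw) all_cat => /andP[].
have [t [u [pt st t1 tn]]] := gao_reflections_coprime6 n_gt1 n_co6 (fun g => val (F2 g)) sr k1.
by exists t, u; split=> //; exact: coordinates_prod1.
Qed.

(** Among 9n terms one is deleted so that the number of reflections does not become or remain one: a
    lone reflection itself, or a rotation if there are two reflections. *)
Lemma long_has_one (r : seq gT) : 9 * n <= size r -> has_one_subseq r (6 * n).
Proof.
move=> sr; set k := count (odd_elt F1) (take (9 * n) r).
have pr : perm_eq r (take (9 * n) r ++ drop (9 * n) r) by rewrite cat_take_drop.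
apply: has_one_subseq_sub pr _.
have st : size (take (9 * n) r) = 9 * n by rewrite size_takel.
have del (a : pred gT) : 0 < count a (take (9 * n) r) ->
    (forall g, a g -> k - odd_elt F1 g != 1) -> has_one_subseq (take (9 * n) r) (6 * n).
  move=> /has_perm_cons[g [r' [pr' ag]]] /(_ g ag) kg.
  have pr2 : perm_eq (take (9 * n) r) (r' ++ [:: g]) by perm_lia.
  apply: has_one_subseq_sub pr2 _; apply: not_one_reflection.
    by have := perm_size pr'; rewrite st /= => e; clear -e; lia.
  by move: kg; rewrite /k (seq.permP pr') /= addKn.
have kE := count_predC (odd_elt F1) (take (9 * n) r); rewrite st -/k in kE.
case: (ltngtP k 2) => k2.
- case: (posnP k) => k0.
    apply: (del predT); first by rewrite count_predT st; clear -n_gt1; lia.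
    by move=> g _; rewrite k0.
  apply: (del (odd_elt F1)) => // g ->; clear -k0 k2; lia.
- apply: (del predT); first by rewrite count_predT st; clear -n_gt1; lia.
  by move=> g _; case: (odd_elt F1 g); clear -k2; lia.
- apply: (del (predC (odd_elt F1))); first by rewrite -(ltn_add2l k) addn0 kE k2; clear -n_gt1; lia.
  by move=> g /= /negbTE ->; rewrite k2.
Qed.

Lemma pow_mod a b : a = b %[mod 3 * n] -> (y ^+ a = y ^+ b)%g.
Proof.
have [_ ym _] := rels; move=> ab.
by rewrite -(expg_mod a ym) ab expg_mod.
Qed.

(** Exactly one term is a reflection, and two disjoint blocks of length 3n among the 9n - 2
    rotations would give a product-one subsequence; the inverse theorem determines these
    rotations. *)
Lemma extremal_form r : size r = 9 * n - 1 -> ~ has_one_subseq r (6 * n) ->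
  exists a b e : nat, gcdz (a%:Z - b%:Z)%R (3 * n)%:Z = 1%Z /\
    perm_eq r (nseq (6 * n - 1) (y ^+ a)%g ++ nseq (3 * n - 1) (y ^+ b)%g ++ [:: (x * y ^+ e)%g]).
Proof.
move=> sr nr; have k1 : count (odd_elt F1) r = 1.
  by apply/eqP/negPn/negP => /(not_one_reflection sr).
have [|g [r' [pr og]]] := @has_perm_cons _ (odd_elt F1) r; first by rewrite k1.
have rr : all (predC (odd_elt F1)) r'.
  rewrite all_predC has_count; have := seq.permP pr (odd_elt F1); rewrite k1 /= og; clear; lia.
have sr' : size r' = 3 * (3 * n) - 2 by have := perm_size pr; rewrite sr /=; clear; lia.
have om : odd (3 * n).
  rewrite oddM /=; have : coprime 2 n by apply: coprime_dvdl n_co6.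
  by rewrite coprime2n.
have m1 : 1 < 3 * n by clear -n_gt1; lia.
have [a [b [ab ca cb]]] : exists a b, [/\ a != b %[mod 3 * n],
    count (cong exponent (3 * n) a) r' = (3 * n).*2.-1 & count (cong exponent (3 * n) b) r' = (3 * n).-1].
  apply: no_disjoint_blocks_counts => //; first exact: inverse_egz_odd.
  move=> [t1 [t2 [u [pt b1 b2]]]]; apply: nr.
  have /andP[/eqP s1 d1] := b1; have /andP[/eqP s2 d2] := b2.
  exists (t1 ++ t2), (g :: u); split.
  - by clear -pr pt; perm_lia.
  - by rewrite size_cat s1 s2; clear; lia.
  apply: rotations_prod1; last by rewrite big_cat /= dvdn_add.
  by move: rr; rewrite (perm_all _ pt) !all_cat => /and3P[-> ->].
have class c : all (pred1 (y ^+ c)%g) (filter (cong exponent (3 * n) c) r').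
  apply/allP => h; rewrite mem_filter => /andP[/eqP hc hr] /=; apply/eqP.
  by rewrite (exponentE h) (negbTE (allP rr _ hr)) mul1g; apply: pow_mod.
have pr' : perm_eq r' (nseq (6 * n - 1) (y ^+ a)%g ++ nseq (3 * n - 1) (y ^+ b)%g).
  have /all_pred1P := class a; rewrite size_filter ca => ea.
  have /all_pred1P := class b; rewrite size_filter cb => eb.
  have -> : 6 * n - 1 = (3 * n).*2.-1 by clear; lia.
  have -> : 3 * n - 1 = (3 * n).-1 by clear; lia.
  rewrite -ea -eb perm_sym.
  have <- : filter (predC (cong exponent (3 * n) a)) r' = filter (cong exponent (3 * n) b) r'.
    apply: eq_in_filter => h hr; have /= hab : predU (cong exponent (3 * n) a) (cong exponent (3 * n) b) h.
      apply: (allP (two_values_all ab _)) hr.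
      by rewrite ca cb sr'; clear -n_gt1; lia.
    rewrite /=; case/orP: hab => /eqP hh; rewrite hh eqxx //=.
      by rewrite (negbTE ab).
    by rewrite eq_sym ab.
  by rewrite perm_filterC.
exists a, b, (exponent g); split; last first.
  have -> : (x * y ^+ exponent g)%g = g by rewrite [RHS]exponentE og.
  by clear -pr pr'; perm_lia.
apply/eqP; case: (eqVneq (gcdz (a%:Z - b%:Z)%R (3 * n)%:Z) 1%Z) => // gn; exfalso; apply: nr.
(* If d > 1, then for q = 3n / d the q-th powers of y^a and y^b agree, so 6n - q copies of y^a and q
   copies of y^b have product one. *)
set d := gcdn `|(a%:Z - b%:Z)%R| (3 * n).
have d1 : d != 1 by apply: contra gn => /eqP e; rewrite /gcdz /= -/d e.
have /dvdnP[q qd] : d %| 3 * n by exact: dvdn_gcdr.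
have abd : a = b %[mod d].
  have : (d%:Z %| (a%:Z - b%:Z)%R)%Z by rewrite dvdzE /= dvdn_gcdl.
  by rewrite -eqz_mod_dvd !modz_nat => /eqP [].
have abq : q * a = q * b %[mod 3 * n] by rewrite qd -!muln_modr abd.
have q0 : 0 < q by case: (q) qd m1 => // ->.
have qm : q < 3 * n.
  have d0 : 1 < d by move: d1 qd m1; case: (d) => [|[|]] // _ ->; rewrite muln0.
  by rewrite qd -{1}(muln1 q) ltn_pmul2l.
have [ym1 ym2] : 6 * n - 1 = (6 * n - q) + (q - 1) /\ 3 * n - 1 = q + (3 * n - 1 - q).
  by move: q0 qm; clear; lia.
exists (nseq (6 * n - q) (y ^+ a)%g ++ nseq q (y ^+ b)%g),
  (nseq (q - 1) (y ^+ a)%g ++ nseq (3 * n - 1 - q) (y ^+ b)%g ++ [:: g]); split.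
- by rewrite ym1 ym2 !nseqD in pr'; clear -pr pr'; perm_lia.
- by rewrite size_cat !size_nseq; move: qm; clear; lia.
have [_ ym _] := rels.
have pn i (h : gT) : (\prod_(z <- nseq i h) z = h ^+ i)%g.
  by elim: i => [|i IH]; rewrite ?big_nil // big_cons IH expgS.
rewrite big_cat /= !pn -!expgM -expgD [b * q]mulnC.
rewrite (pow_mod (_ : _ = (6 * n - q) * a + q * a %[mod _])); last first.
  by rewrite [a * _]mulnC -modnDmr -abq modnDmr.
rewrite -mulnDl subnK; last by move: qm; clear; lia.
by rewrite (_ : 6 * n * a = 3 * n * (2 * a)); [rewrite expgM ym expg1n | clear; lia].
Qed.

End Coordinates.

(** * Extremal sequences and the lower bound *)

Lemma two_values_sum (t1 t2 : int) i j n : i + j = 6 * n ->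
  (t1 *+ i + t2 *+ j = (t1 - t2) * i%:Z + (3 * n)%:Z * (2 * t2))%R.
Proof.
move=> ij; have jE : (j%:Z = 6 * n%:Z - i%:Z)%R by lia.
by rewrite !pmulrn !mulrzz jE PoszM; ring.
Qed.

(** By parity the reflection is avoided, leaving i and j copies of the two powers with i + j = 6n.
    The total exponent is divisible by 3 and by n; as t1 - t2 is prime to 3n, it follows that 3n
    divides i, although 3n < i < 6n. *)
Lemma extremal_no_one n (gT : finGroupType) (alpha tau : gT)
    (F1 : {multiplicative gT -> D3}) (F2 : {multiplicative gT -> 'Z_n}) (t1 t2 t3 : int) r :
  1 < n -> coprime 3 n -> F1 alpha = (false, 1%R) -> F1 tau = (true, 0%R) ->
  F2 alpha = 1%R -> F2 tau = 0%R -> gcdz (t1 - t2)%R (3 * n)%:Z = 1%Z ->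
  perm_eq r (nseq (6 * n - 1) (expgz alpha t1) ++ nseq (3 * n - 1) (expgz alpha t2)
             ++ [:: (tau * expgz alpha t3)%g]) -> ~ has_one_subseq r (6 * n).
Proof.
move=> n1 co3 F1a F1t F2a F2t g1 pr [t [u [pt st pt1]]].
set A := expgz alpha t1 in pr *; set B := expgz alpha t2 in pr *; set C := (tau * _)%g in pr *.
have F1A z : F1 (expgz alpha z) = (false, z%:~R%R) by rewrite mult_map_expgz F1a expgz_rot.
have F2A z : F2 (expgz alpha z) = z%:~R%R by rewrite mult_map_expgz F2a expgz_Zp.
have F1C : (F1 C).1 by rewrite /C gmulfM F1t F1A.
have prt : (\prod_(i <- t) F1 i = 1)%g by rewrite -mult_map_prod pt1 mult_map1.
have odd_A : odd_elt F1 A = false by rewrite /odd_elt F1A.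
have odd_B : odd_elt F1 B = false by rewrite /odd_elt F1A.
have c1 : count (odd_elt F1) t = 0.
  have := prod_parity F1 t; rewrite prt /=.
  have : count (odd_elt F1) t <= 1.
    apply: (@leq_trans (count (odd_elt F1) r)); first by rewrite (seq.permP pt) count_cat leq_addr.
    by rewrite (seq.permP pr) !count_cat !count_nseq odd_A odd_B /= [odd_elt F1 C]F1C.
  by case: (count _ t) => [|[|]].
have rt : all (predC (odd_elt F1)) t by rewrite all_predC has_count c1.
have AB : all (pred2 A B) t.
  apply/allP => g gt; have : g \in r by rewrite (perm_mem pt) mem_cat gt.
  rewrite (perm_mem pr) !mem_cat !mem_nseq inE => /or3P[/andP[_]|/andP[_]|/eqP gC] /=.
  - by move=> ->.
  - by move=> ->; rewrite orbT.
  - by have := allP rt _ gt; rewrite /= /odd_elt gC F1C.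
have nAB : A != B.
  apply/eqP => e; have e3 := congr1 F1 e; rewrite !F1A in e3.
  have /eqP := congr1 snd e3; rewrite /= -subr_eq0 -rmorphB (@intr_Zp_eq0 3) // => d3.
  have : (3%:Z %| gcdz (t1 - t2)%R (3 * n)%:Z)%Z.
    by rewrite dvdz_gcd d3 dvdzE /= dvdn_mulr.
  by rewrite g1.
set i := count_mem A t; set j := count_mem B t.
have ij : i + j = 6 * n.
  rewrite -st -count_predUI [X in _ + X](@eq_count _ _ pred0) ?count_pred0 ?addn0.
    by apply/eqP; rewrite -all_count.
  by move=> g /=; apply/negP => /andP[/eqP -> /eqP e]; rewrite e eqxx in nAB.
have i_le : i <= 6 * n - 1.
  apply: (@leq_trans (count_mem A r)); first by rewrite (seq.permP pt) count_cat leq_addr.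
  rewrite (seq.permP pr) !count_cat !count_nseq /= eqxx (eq_sym B) (negbTE nAB).
  have -> : (C == A) = false by apply/negP => /eqP e; move: odd_A; rewrite -e /odd_elt F1C.
  by clear; lia.
have j_le : j <= 3 * n - 1.
  apply: (@leq_trans (count_mem B r)); first by rewrite (seq.permP pt) count_cat leq_addr.
  rewrite (seq.permP pr) !count_cat !count_nseq /= eqxx (negbTE nAB).
  have -> : (C == B) = false by apply/negP => /eqP e; move: odd_B; rewrite -e /odd_elt F1C.
  by clear; lia.
have sumAB (R : zmodType) (f : gT -> R) : (\sum_(g <- t) f g = f A *+ i + f B *+ j)%R.
  rewrite /i /j; elim: (t) AB => [|g l IH] /=; first by rewrite big_nil addr0.
  case/andP=> gAB /IH e; rewrite big_cons e.
  case/orP: gAB => /eqP ->; rewrite eqxx ?(negbTE nAB) ?(eq_sym B) ?(negbTE nAB) /=.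
    by rewrite add0n mulrS addrA.
  by rewrite add0n mulrS addrCA.
pose v := (t1 *+ i + t2 *+ j)%R.
have d3 : (3%:Z %| v)%Z.
  rewrite -(@intr_Zp_eq0 3) // /v rmorphD !rmorphMn /=.
  have := congr1 snd prt; rewrite (prod_rotations rt) /= sumAB !F1A /= => ->; exact: eqxx.
have dn : (n%:Z %| v)%Z.
  rewrite -(@intr_Zp_eq0 n) // /v rmorphD !rmorphMn /= -!F2A -/A -/B -sumAB.
  have <- : (\prod_(g <- t) F2 g)%g = (\sum_(g <- t) F2 g)%R by [].
  by rewrite -mult_map_prod pt1 mult_map1.
have dm : ((3 * n)%:Z %| v)%Z.
  by rewrite PoszM Gauss_dvdz ?d3 ?dn // coprimezE.
have vE : (v = (t1 - t2) * i%:Z + (3 * n)%:Z * (2 * t2))%R by exact: two_values_sum.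
have : ((3 * n)%:Z %| ((t1 - t2) * i%:Z)%R)%Z.
  by move: dm; rewrite vE rpredDr // dvdz_mulr.
rewrite Gauss_dvdzr; last by rewrite /coprimez gcdzC g1.
rewrite dvdzE /= => /dvdnP[q qE].
move: ij i_le j_le; rewrite qE; case: q {qE} => [|[|q]]; move: n1; clear; nia.
Qed.

Unset Implicit Arguments.

Theorem theorem1p1 (n2 : nat) (s : int) (gT : finGroupType) (x y : gT)
    (n2_gt0 : 0 < n2) (n2_neq1 : n2 <> 1) (n2_co6 : gcdn 6 n2 = 1)
    (s_mod3 : (s = -1 %[mod 3])%Z) (s_modn2 : (s = 1 %[mod n2%:Z])%Z)
    (presG : semidirect_presentation (3 * n2) s y x) :
  is_gao_constant gT (9 * n2) /\
  (forall S : {mset gT}%mset, size S = 9 * n2 - 1 ->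
     ~ has_product_one_subseq S (6 * n2) <->
     exists alpha tau : gT,
       semidirect_presentation (3 * n2) s alpha tau /\
       exists t1 t2 t3 : int,
         gcdz (t1 - t2)%R (3 * n2)%:Z = 1%Z /\
         S = (msetn (6 * n2 - 1) (expgz alpha t1)
              `+` msetn (3 * n2 - 1) (expgz alpha t2)
              `+` [mset (tau * expgz alpha t3)%g])%mset).
Proof.
have n_gt1 : 1 < n2 by lia.
have co6 : coprime 6 n2 by rewrite /coprime n2_co6.
have co3 : coprime 3 n2 by exact: coprime_dvdl co6.
(* The congruences of [s] modulo 3 and modulo [n2] are what the relations require in S3 and in
   Z/n. *)
have coords (a t : gT) : semidirect_presentation (3 * n2) s a t ->
    exists (F1 : {multiplicative gT -> D3}) (F2 : {multiplicative gT -> 'Z_n2}),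
    [/\ F1 a = (false, 1%R), F1 t = (true, 0%R), F2 a = 1%R & F2 t = 0%R].
  case=> _ _ univ; have [F1 [F1a F1t]] := univ _ _ _ (D3_rels n2 s_mod3).
  by have [F2 [F2a F2t]] := univ _ _ _ (Zp_rels n_gt1 s_modn2); exists F1, F2.
have no_one (a t : gT) (t1 t2 t3 : int) : semidirect_presentation (3 * n2) s a t ->
    gcdz (t1 - t2)%R (3 * n2)%:Z = 1%Z ->
    ~ has_product_one_subseq (msetn (6 * n2 - 1) (expgz a t1)
        `+` msetn (3 * n2 - 1) (expgz a t2) `+` [mset (t * expgz a t3)%g])%mset (6 * n2).
  move=> /coords[F1 [F2 [F1a F1t F2a F2t]]] g1; rewrite has_product_one_subseqE.
  by apply: (extremal_no_one n_gt1 co3 F1a F1t F2a F2t g1 (t3 := t3)); apply/mset_of_perm.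
have [F1 [F2 [F1y F1x F2y F2x]]] := coords _ _ presG; have [gen rels _] := presG.
have cG := card_gT n_gt1 co6 gen rels F1y F1x F2y F2x.
split; last first.
  move=> S sS; split=> [|[a [t [pres [t1 [t2 [t3 [g1 ->]]]]]]]]; last exact: no_one.
  rewrite has_product_one_subseqE => nS.
  have [a [b [e [g1 pS]]]] := extremal_form n_gt1 co6 gen rels F1y F1x F2y F2x sS nS.
  exists y, x; split=> //; exists (Posz a), (Posz b), (Posz e); split=> //.
  exact/mset_of_perm.
split; first by rewrite muln_gt0 n2_gt0.
  move=> S sS; rewrite cG; apply/has_product_one_subseqE.
  exact: (long_has_one n_gt1 co6 gen rels F1y F1x F2y F2x).
move=> l l0 gl; rewrite leqNgt; apply/negP => ll.
(* The extremal sequence with exponents 1 and 0 has 9n - 1 terms and gives the lower bound. *)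
have g10 : gcdz (1 - 0)%R (3 * n2)%:Z = 1%Z by rewrite subr0 gcd1z.
apply: (no_one y x 1%Z 0%Z 0%Z presG g10); rewrite -cG; apply: gl.
rewrite (perm_size (proj2 (mset_of_perm _ _ _ _ _ _) erefl)) !size_cat !size_nseq.
by rewrite cG /=; move: ll; clear -n_gt1; lia.
Qed.
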